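(* Let $$\mathbf{C}=\inf_{0\neq F\in\mathcal{A}}\frac{\max\{\|\mathcal{H}(F)\|_{L^\infty(\mathbb{R})},\ \|\mathcal{H}(f_F)\|_{L^\infty(\mathbb{R}/\mathbb{Z})}\}}{\|F\|_{L^1(\mathbb{R})}}.$$ If $P(z)\in\mathbb{C}[z]$ is a monic polynomial of degree $N$ with $P(0)\neq 0$, then $$\mathcal{D}(P)\le \frac{4\sqrt{\mathbf{C}}}{\sqrt{\pi}}\,\sqrt{N\,h(P)}.$$
   Context: Polynomials. Write $P(z)=\prod_{j=1}^N (z-\alpha_j)=z^N+a_{N-1}z^{N-1}+\cdots+a_0$ with $N\ge 1$ and $a_0=P(0)\neq 0$, where the roots (listed with multiplicity) are $\alpha_j=\rho_j e^{2\pi i\theta_j}$, $\rho_j>0$, $\theta_j\in\mathbb{R}/\mathbb{Z}$. Let $\log^+ x=\max\{\log x,0\}$ (with $\log^+ 0=0$) and $$h(P)=\int_0^1 \log^+\!\left(\frac{|P(e^{2\pi i\theta})|}{\sqrt{|a_0|}}\right)d\theta .$$ For an interval $I\subset\mathbb{R}/\mathbb{Z}$ of length $|I|$ (a single point is allowed as an interval), let $N(I;P)$ be the number of indices $j$ with $\theta_j\in I$ (with multiplicity). The discrepancy is $\mathcal{D}(P)=\sup_I |N(I;P)-|I|\,N|$, the supremum being over all intervals $I\subset\mathbb{R}/\mathbb{Z}$. Function class. $\mathcal{A}$ is the class of functions $F:\mathbb{R}\to\mathbb{R}$ that are even, continuous and non-negative, with $\mathrm{supp}(F)\subseteq[-\tfrac12,\tfrac12]$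 and $\widehat F\in L^1(\mathbb{R})$, where $\widehat F(t)=\int_{\mathbb{R}}e^{-2\pi i t x}F(x)\,dx$. For $F\in\mathcal{A}$ its periodization is $f_F:\mathbb{R}/\mathbb{Z}\to\mathbb{R}$, $f_F(\theta)=\sum_{k\in\mathbb{Z}}F(\theta+k)$; its Fourier coefficients are $\widehat{f_F}(k)=\int_{\mathbb{R}/\mathbb{Z}}e^{-2\pi i k\theta}f_F(\theta)\,d\theta=\widehat F(k)$, and they are absolutely summable. Hilbert transforms. For $F\in\mathcal{A}$, the Hilbert transforms on $\mathbb{R}$ and on $\mathbb{R}/\mathbb{Z}$ are the bounded continuous functions given by Fourier inversion: $$\mathcal{H}(F)(x)=\int_{\mathbb{R}}-i\,\mathrm{sgn}(t)\,\widehat F(t)\,e^{2\pi i t x}\,dt,\qquad \mathcal{H}(f_F)(\theta)=\sum_{k\in\mathbb{Z}}-i\,\mathrm{sgn}(k)\,\widehat{f_F}(k)\,e^{2\pi i k\theta},$$ with $\mathrm{sgn}(0)=0$. Equivalently (a.e.), $\mathcal{H}(F)(x)=\mathrm{p.v.}\,\frac1\pi\int_{\mathbb{R}}F(x-t)\frac{dt}{t}$ and $\mathcal{H}(f_F)(\theta)=\mathrm{p.v.}\int_{\mathbb{R}/\mathbb{Z}}f_F(\theta-\alpha)\cot(\pi\alpha)\,d\alpha$. *)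

(* Defs.v *)
(* The complex numbers are R[i], over an arbitrary R : realType. *)
From HB Require Import structures.
From mathcomp Require Export all_boot all_order all_algebra.
From mathcomp Require Export all_classical all_reals all_analysis.
From mathcomp Require Export complex.
Set Implicit Arguments.
Unset Strict Implicit.
Unset Printing Implicit Defensive.
Import Order.TTheory GRing.Theory Num.Theory numFieldNormedType.Exports.

Local Open Scope classical_set_scope.
Local Open Scope complex_scope.
Local Open Scope ring_scope.

(* Functions on the circle R/Z are represented by 1-periodic functions on R,
   integrated over a period [0, 1]. *)

Local Notation normc := Normc.normc.

Section complex_analysis.
Context {R : realType}.
Local Notation Re := (@complex.Re R).
Local Notation Im := (@complex.Im R).
Implicit Types (f : R -> R[i]) (D : set R).
Local Notation mu := (@lebesgue_measure R).

(* e(t) = exp(2 pi i t) *)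
Definition cis (t : R) : R[i] := cos (2 * pi * t) +i* sin (2 * pi * t).

Definition cintegral D f : R[i] :=
  (\int[mu]_(x in D) Re (f x))%R +i* (\int[mu]_(x in D) Im (f x))%R.

Definition cintegrable D f : Prop :=
  mu.-integrable D (fun x => (Re (f x))%:E) /\
  mu.-integrable D (fun x => (Im (f x))%:E).

Definition climn (u : nat -> R[i]) : R[i] :=
  limn (fun n => Re (u n)) +i* limn (fun n => Im (u n)).

(* The sum of c over all of Z, as the limit of the partial sums over
   -n <= k <= n; it is only used for absolutely summable c, for which the order
   of summation is irrelevant. *)
Definition csumZ (c : int -> R[i]) : R[i] :=
  climn (fun n => \sum_(j < n.*2.+1) c (j%:Z - n%:Z)).

End complex_analysis.

Section function_class.
Context {R : realType}.
Implicit Types F f : R -> R.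
Local Notation mu := (@lebesgue_measure R).

Definition fourier F (t : R) : R[i] :=
  cintegral setT (fun x => cis (- (t * x)) * (F x)%:C).

Definition classA : set (R -> R) := [set F : R -> R |
  [/\ (forall x, F (- x) = F x),
      continuous F,
      (forall x, 0 <= F x),
      closure [set x | F x != 0] `<=` `[- 2^-1, 2^-1] &
      cintegrable setT (fourier F)]].

(* A sum with finite support for every theta when F has compact support. *)
Definition periodization F (theta : R) : R :=
  \sum_(k \in [set: int]) F (theta + k%:~R).

Definition fourier_coef f (k : int) : R[i] :=
  cintegral `[0, 1] (fun theta => cis (- (k%:~R * theta)) * (f theta)%:C).

Definition hilbert_line F (x : R) : R[i] :=
  cintegral setT (fun t => - 'i%C * (Num.sg t)%:C * fourier F t * cis (t * x)).

Definition hilbert_circle f (theta : R) : R[i] :=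
  csumZ (fun k => - 'i%C * (Num.sg k)%:~R * fourier_coef f k
                  * cis (k%:~R * theta)).

Local Open Scope ereal_scope.

Definition mu_circle : {measure set (measurableTypeR R) -> \bar R} :=
  mrestr mu (measurable_itv `[0%R, 1%R]).

Definition constC : \bar R := ereal_inf [set q | exists F : R -> R,
  [/\ classA F, F <> cst 0%R &
      q = maxe (Lnorm mu +oo (fun x => (normc (hilbert_line F x))%:E))
               (Lnorm mu_circle +oo
                  (fun x => (normc (hilbert_circle (periodization F) x))%:E))
          / Lnorm mu 1 (fun x => (F x)%:E)]].

End function_class.

Section polynomials.
Context {R : realType}.
Implicit Type P : {poly R[i]}.
Local Notation mu := (@lebesgue_measure R).

Definition logp (x : R) : R := Num.max (ln x) 0.

Definition height P : \bar R :=
  (\int[mu]_(theta in `[0%R, 1%R])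
     (logp (normc P.[cis theta] / Num.sqrt (normc P`_0)))%:E)%E.

(* The roots of P, listed with multiplicity. *)
Definition roots P : seq R[i] := sval (closed_field_poly_normal P).

(* The number of roots of P whose angle in R/Z lies in the image of J. *)
Definition count_angles P (J : set R) : nat :=
  count (fun z => `[< exists2 t, J t & z = (normc z)%:C * cis t >]) (roots P).

(* An interval of R/Z of length l is the image of a real interval (with each
   endpoint included or not) with endpoints x <= y = x + l, where l <= 1. *)
Definition discrepancy P : \bar R := ereal_sup [set r |
  exists (b c : bool) (x y : R), x <= y <= x + 1 /\
    r = `|(count_angles P [set` Interval (BSide b x) (BSide c y)])%:R
          - (y - x) * (size P).-1%:R|%:E].

End polynomials.

(* Main.v *)
Require Import Defs.
From mathcomp Require Import ring lra measurable_realfun ess_sup_inf.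
Set Implicit Arguments.
Unset Strict Implicit.
Unset Printing Implicit Defensive.
Import Order.TTheory GRing.Theory Num.Theory numFieldNormedType.Exports.
Local Open Scope classical_set_scope.
Local Open Scope complex_scope.
Local Open Scope ring_scope.

(** The angles of the roots are the jumps of the conjugate function of [log |P|]
on the unit circle, so testing [log |P|] against the conjugate of a bump counts
roots in an interval.

Reduction to the circle. Moving each root radially to the unit circle keeps the
angles and does not increase [|P| / sqrt |a_0|] on the circle ([schur]). Let
[bs] be the list of angles, [Q] the product of the [1 - e(x - b)], and [h] the
integral of [log^+ |Q|], which is at most the height of [P]. Since [log |Q|] has
mean 0, the integral of its absolute value is [2 h] ([itg_norm_logk]).

Pairing. Instead of shrinking [F] to width [1 / l], the circle is stretched to
length [l > 1]. By orthogonality of the characters, the integral over a period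
of [log |Q(x / l)|] against the conjugate Fourier series of the [l]-periodization
of [F] is, up to sign, the integral of [F] against the conjugate function of
[log |Q|], which is a sum of sawtooth functions [pi (stair u - u)] at [u = b - t / l]
([itg_cos_sum_conj], [argk_lim]). So if [M] bounds the limit of the conjugate series, then
  [ |int F(t) sum_b (stair u - u) dt| <= 2 M l h / pi ]
for [Q] and all its rotations ([stair_bound]). The logarithmic singularities
are avoided by working on a circle of radius [r < 1], where the series of
[log |1 - r e(u)|] and its conjugate converge uniformly, and letting [r] tend to
1 afterwards.

The bound [M]. It has to be uniform in [l], while only the cases [l = 1] (the
circle) and [l = oo] (the line) are given. The partial sums of the conjugate
series converge to [hilbertC l] ([conj_sum_cvg]), whose kernel on the circle of
length [l] is [l^-1 cot (pi u / l)], compared to [1 / (pi u)] on the line. The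
difference of two of these kernels is odd and monotone where it is needed, and
[F] is even and nonnegative; therefore, for [0 <= x], the value [hilbertC l x]
lies below the value on the line ([hilbertC_le]), and above the value on the
circle of length 1 when [x < 1/2] ([hilbertC_ge]); for [x > 1/2] it is
nonnegative, because there the kernel is integrated away from its singularity
([hilbertC_ge0]). Hence the larger of the two given sup norms is a bound for
every [l > 1] ([conj_sum_ae_bound]).

Counting. The indicator of an interval lies between the differences of
staircases at the end points of the interval enlarged or shrunk by [1 / (2 l)].
Averaging these against [F], which has mass [m], gives
  [ |N(I) - |I| N| <= N / l + 4 M l h / (pi m) ]
([count_bound]). Choosing [l] to balance the two terms, and using the trivial
bound [N] when the balance is at [l <= 1], gives the square root bound
([sqr_le_of_tradeoff]), and [M / m] may be taken as close to the infimum as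
desired. *)

(** * Integrals of continuous functions over segments *)

Section Integral.
Context {R : realType}.
Implicit Types (f g G : R -> R) (a b c k h x y : R).
Local Notation mu := (@lebesgue_measure R).

Definition itg a b f : R := (\int[mu]_(x in `[a, b]) f x)%R.

Lemma cont_int a b f : continuous f -> mu.-integrable `[a, b] (EFin \o f).
Proof.
move=> cf; apply: continuous_compact_integrable; first exact: segment_compact.
exact: continuous_subspaceT.
Qed.

Lemma cont_meas f : continuous f -> measurable_fun setT f.
Proof. by move=> cf; exact: continuous_measurable_fun. Qed.

Lemma eq_itg a b f g : (forall x, a <= x <= b -> f x = g x) ->
  itg a b f = itg a b g.
Proof.
by move=> fg; apply: eq_Rintegral => x /[1!inE] /=; rewrite in_itv/=; apply: fg.
Qed.

Lemma itgZ a b k f : continuous f -> itg a b (fun x => k * f x) = k * itg a b f.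
Proof. by move=> cf; rewrite /itg RintegralZl//; exact: cont_int. Qed.

Lemma itgN a b f : continuous f -> itg a b (fun x => - f x) = - itg a b f.
Proof.
by move=> cf; rewrite -mulN1r -itgZ//; apply: eq_itg => x _; rewrite mulN1r.
Qed.

Lemma itgD a b f g : continuous f -> continuous g ->
  itg a b (fun x => f x + g x) = itg a b f + itg a b g.
Proof. by move=> cf cg; rewrite /itg RintegralD//; exact: cont_int. Qed.

Lemma itgB a b f g : continuous f -> continuous g ->
  itg a b (fun x => f x - g x) = itg a b f - itg a b g.
Proof. by move=> cf cg; rewrite /itg RintegralB//; exact: cont_int. Qed.

Lemma cont_sum (I : Type) (s : seq I) (P : pred I) (f : I -> R -> R) :
  (forall i, continuous (f i)) -> continuous (fun x => \sum_(i <- s | P i) f i x).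
Proof.
move=> cf x; apply: cvg_big => //; first exact: add_continuous.
by move=> i _; apply: cf.
Qed.

Lemma itg_sum (I : Type) (s : seq I) a b (f : I -> R -> R) :
  (forall i, continuous (f i)) ->
  itg a b (fun x => \sum_(i <- s) f i x) = \sum_(i <- s) itg a b (f i).
Proof.
move=> cf; elim: s => [|i s ih].
  by under eq_itg do rewrite big_nil; rewrite big_nil /itg Rintegral_cst//= mul0r.
under eq_itg do rewrite big_cons.
by rewrite itgD ?ih ?big_cons//; exact: cont_sum.
Qed.

Lemma le_itg a b f g : continuous f -> continuous g ->
  (forall x, a <= x <= b -> f x <= g x) -> itg a b f <= itg a b g.
Proof.
move=> cf cg fg; by apply: le_Rintegral (cont_int _ _ cf) (cont_int _ _ cg) _.
Qed.

Lemma itg_cst a b k : a <= b -> itg a b (fun=> k) = k * (b - a).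
Proof.
by move=> ab; rewrite /itg Rintegral_cst//= lebesgue_measure_itv/= lte_fin;
  case: ltgtP ab => // -> _; rewrite ?subrr.
Qed.

Lemma itg_ge0 a b f : (forall x, a <= x <= b -> 0 <= f x) -> 0 <= itg a b f.
Proof. by move=> f0; apply: Rintegral_ge0 => x /=; rewrite in_itv/=; apply: f0. Qed.

Lemma cont_norm f : continuous f -> continuous (fun x => `|f x|).
Proof. by move=> cf x; apply: cvg_norm; apply: cf. Qed.

Lemma itg_le_norm a b f g : continuous f -> continuous g ->
  (forall x, a <= x <= b -> `|f x| <= g x) -> `|itg a b f| <= itg a b g.
Proof.
move=> cf cg fg; apply: (@le_trans _ _ (itg a b (fun x => `|f x|))).
  by apply: le_normr_Rintegral => //; exact: cont_int.
by apply: le_itg => //; exact: cont_norm.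
Qed.

Lemma itg_primitive a b f G : a <= b -> continuous f ->
  (forall x, a <= x <= b -> is_derive x 1 G (f x)) -> itg a b f = G b - G a.
Proof.
move=> ab cf dG; move: ab; rewrite le_eqVlt => /predU1P[<-|ab].
  by rewrite subrr /itg set_itv1 Rintegral_set1.
have cG x : a <= x <= b -> {for x, continuous G}.
  move=> /dG h; apply: differentiable_continuous; apply/derivable1_diffP.
  by have [] := h.
rewrite /itg /Rintegral (@continuous_FTC2 _ f G)//.
- exact: continuous_subspaceT.
- split=> [x||].
  + by rewrite in_itv/= => /andP[ax xb]; have [] := dG x; rewrite ?(ltW ax) ?(ltW xb).
  + by apply: cvg_at_right_filter; apply: cG; rewrite lexx ltW.
  + by apply: cvg_at_left_filter; apply: cG; rewrite lexx ltW.
- move=> x; rewrite in_itv/= => /andP[ax xb].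
  have h : is_derive x 1 G (f x) by apply: dG; rewrite !ltW.
  by rewrite derive1E; apply: derive_val.
Qed.

Lemma itg_chasles a b c f : a <= b -> b <= c -> continuous f ->
  itg a c f = itg a b f + itg b c f.
Proof.
move=> ab bc cf; apply/eqP; rewrite addrC -subr_eq; apply/eqP.
rewrite /itg (@Rintegral_itvB _ f (BLeft a) (BRight c) b)//; try exact: cont_int.
by rewrite Rintegral_itv_obnd_cbnd//; apply: integrableS (cont_int b c cf) => //;
  exact: subset_itv_oc_cc.
Qed.

Lemma ex_primitive f : continuous f -> exists G, forall x, is_derive x 1 G (f x).
Proof.
(* An integral over an empty segment is 0, so the first term is the primitive on
the right of 0 and the second one on the left. *)
move=> cf; exists (fun x => itg 0 x f - itg x 0 f) => x.
pose a := Num.min 0 x - 1.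
have ax : a < x by rewrite /a ltrBlDr gt_min (ltrDl x) ltr01 orbT.
have a0 : a < 0 by rewrite /a subr_lt0 gt_min ltr01.
have E y : a < y -> itg 0 y f - itg y 0 f = itg a y f - itg a 0 f.
  move=> ay; have [y0|y0] := leP y 0.
    rewrite (itg_chasles (ltW ay) y0 cf) opprD addrA subrr sub0r.
    rewrite /itg; move: y0; rewrite le_eqVlt => /predU1P[->|y0].
      by rewrite set_itv1 Rintegral_set1 oppr0 addr0.
    by rewrite (set_itv_ge (b1:=BLeft (0:R))) ?Rintegral_set0 ?sub0r// bnd_simp -ltNge.
  rewrite (itg_chasles (ltW a0) (ltW y0) cf) addrAC subrr add0r.
  by rewrite /itg (set_itv_ge (b1:=BLeft y)) ?Rintegral_set0 ?subr0// bnd_simp -ltNge.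
apply: (@near_eq_is_derive _ _ _ (fun y => itg a y f - itg a 0 f)).
  by near=> y; rewrite E//; near: y; exact: lt_nbhsr.
have [d1 d2] := @continuous_FTC1_closed _ f a x (x + 1) ltac:(by rewrite ltrDl)
  (cont_int _ _ cf) ax (cf x).
have D : is_derive x 1 (fun y => itg a y f) (f x).
  by apply: DeriveDef; [exact: d1|rewrite -derive1E; exact: d2].
by apply: is_derive_eq; rewrite subr0.
Unshelve. all: by end_near. Qed.
End Integral.

Section Continuity.
Context {R : realType}.
Implicit Types (f g : R -> R).

Lemma contD f g : continuous f -> continuous g -> continuous (fun x => f x + g x).
Proof. by move=> cf cg x; apply: cvgD; [apply: cf|apply: cg]. Qed.
Lemma contN f : continuous f -> continuous (fun x => - f x).
Proof. by move=> cf x; apply: cvgN; apply: cf. Qed.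
Lemma contM f g : continuous f -> continuous g -> continuous (fun x => f x * g x).
Proof. by move=> cf cg x; apply: cvgM; [apply: cf|apply: cg]. Qed.
Lemma contX f n : continuous f -> continuous (fun x => f x ^+ n).
Proof. by move=> cf x; apply: (@continuous_comp _ _ _ f (fun y => y ^+ n)); [apply: cf|exact: exprn_continuous]. Qed.
Lemma contC f g : continuous f -> continuous g -> continuous (fun x => f (g x)).
Proof. by move=> cf cg x; apply: continuous_comp; [apply: cg|apply: cf]. Qed.
Lemma contcos f : continuous f -> continuous (fun x => cos (f x)).
Proof. by apply: contC; exact: continuous_cos. Qed.
Lemma contsin f : continuous f -> continuous (fun x => sin (f x)).
Proof. by apply: contC; exact: continuous_sin. Qed.
Lemma contatan f : continuous f -> continuous (fun x => atan (f x)).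
Proof. by apply: contC; exact: continuous_atan. Qed.
Lemma contln f : continuous f -> (forall x, 0 < f x) -> continuous (fun x => ln (f x)).
Proof.
by move=> cf f0 x; apply: continuous_comp; [apply: cf|apply: continuous_ln].
Qed.
Lemma contV f : continuous f -> (forall x, f x != 0) -> continuous (fun x => (f x)^-1).
Proof. by move=> cf f0 x; apply: continuousV => //; apply: cf. Qed.
Lemma contcst (k : R) : continuous (fun _ : R => k).
Proof. by move=> x; exact: cvg_cst. Qed.
Lemma contid : continuous (fun x : R => x).
Proof. by move=> x; exact: cvg_id. Qed.
Lemma contmax f g : continuous f -> continuous g ->
  continuous (fun x => Num.max (f x) (g x)).
Proof. by move=> cf cg x; apply: continuous_max; [apply: cf|apply: cg]. Qed.
Lemma contmin f g : continuous f -> continuous g ->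
  continuous (fun x => Num.min (f x) (g x)).
Proof. by move=> cf cg x; apply: continuous_min; [apply: cf|apply: cg]. Qed.

Lemma derivable_cont f (df : R -> R) :
  (forall x : R, is_derive x (1 : R) f (df x)) -> continuous f.
Proof.
move=> d x; apply: differentiable_continuous; apply/derivable1_diffP.
by have [] := d x.
Qed.

Lemma is_derive_aff f (k h x d : R) : is_derive (k * x + h) 1 f d ->
  is_derive x 1 (fun y => f (k * y + h)) (k * d).
Proof.
move=> D; rewrite mulrC.
apply: (@is_derive1_comp _ f (fun y => k * y + h) x d k).
by apply: is_derive_eq; rewrite addr0 /GRing.scale/= mulr1.
Qed.
End Continuity.

(** Continuity by descent on the syntax of the function; the last clause handles
the application of a function whose continuity is a hypothesis. *)
Ltac cont1 := lazymatch goal with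
  | |- continuous (fun _ => ?c) => exact (contcst (k := c))
  | |- continuous (fun x => x) => exact contid
  | |- continuous id => exact contid
  | |- continuous (fun x => @?f x + @?g x) => refine (@contD _ f g _ _)
  | |- continuous (fun x => - @?f x) => refine (@contN _ f _)
  | |- continuous (fun x => @?f x * @?g x) => refine (@contM _ f g _ _)
  | |- continuous (fun x => @?f x ^+ ?n) => refine (@contX _ f n _)
  | |- continuous (fun x => cos (@?f x)) => refine (@contcos _ f _)
  | |- continuous (fun x => sin (@?f x)) => refine (@contsin _ f _)
  | |- continuous (fun x => atan (@?f x)) => refine (@contatan _ f _)
  | |- continuous (fun x => Num.max (@?f x) (@?g x)) => refine (@contmax _ f g _ _)
  | |- continuous (fun x => Num.min (@?f x) (@?g x)) => refine (@contmin _ f g _ _)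
  | |- continuous (fun x => `|@?f x|) => refine (@cont_norm _ f _)
  | |- continuous (fun x => \sum_(i <- _ | _) _) => apply: cont_sum => ?
  | |- continuous (fun x => ?g (@?h x)) => match goal with H : continuous ?f |- _ =>
      constr_eq f g; refine (@contC _ f h H _) end
  end.
Ltac cont := repeat (cbv beta; first
  [ match goal with H : continuous ?f |- continuous ?g => constr_eq f g; exact H end
  | cont1 ]).

Section ChangeOfVariables.
Context {R : realType}.
Implicit Types (f g G : R -> R) (a b c k h x y : R).

Lemma itg_aff a b k h f : a <= b -> 0 < k -> continuous f ->
  itg a b (fun x => f (k * x + h)) = k^-1 * itg (k * a + h) (k * b + h) f.
Proof.
move=> ab k0 cf; have [G dG] := ex_primitive cf.
rewrite (@itg_primitive _ (k * a + h) _ f G)//; last by rewrite lerD2r ler_pM2l.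
rewrite mulrBr; apply: (@itg_primitive _ a b _ (fun x => k^-1 * G (k * x + h))) => //.
  by cont.
move=> x _; have D := is_derive_aff (dG (k * x + h)).
by apply: is_derive_eq; rewrite /GRing.scale/= mulKf// gt_eqF.
Qed.

Lemma itg_shift a b h f : a <= b -> continuous f ->
  itg a b (fun x => f (x + h)) = itg (a + h) (b + h) f.
Proof.
move=> ab cf; have := @itg_aff a b 1 h f ab ltr01 cf.
by rewrite invr1 !mul1r => <-; apply: eq_itg => x _; rewrite mul1r.
Qed.

Lemma itg_opp a b f : a <= b -> continuous f ->
  itg a b (fun x => f (- x)) = itg (- b) (- a) f.
Proof.
move=> ab cf; have [G dG] := ex_primitive cf.
rewrite (@itg_primitive _ (- b) _ f G)//; last by rewrite lerN2.
have -> : G (- a) - G (- b) = - G (-1 * b + 0) - - G (-1 * a + 0).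
  by rewrite !mulN1r !addr0 opprK addrC.
apply: (@itg_primitive _ a b _ (fun x => - G (-1 * x + 0))) => //; first by cont.
move=> x _; have D := is_derive_aff (dG (-1 * x + 0)).
by apply: is_derive_eq; rewrite !mulN1r addr0 opprK.
Qed.

Lemma itg_odd a f : 0 <= a -> continuous f -> (forall x, f (- x) = - f x) ->
  itg (- a) a f = 0.
Proof.
move=> a0 cf of_; have aa : - a <= a by rewrite (le_trans _ a0)// oppr_le0.
have := itg_opp aa cf; rewrite opprK; under eq_itg do rewrite of_.
by rewrite itgN// => /eqP; rewrite eq_sym -addr_eq0 -mulr2n mulrn_eq0 => /eqP.
Qed.

Lemma itg_even a f : 0 <= a -> continuous f -> (forall x, f (- x) = f x) ->
  itg (- a) a f = 2 * itg 0 a f.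
Proof.
move=> a0 cf ef; have a0' : - a <= 0 by rewrite oppr_le0.
rewrite (itg_chasles a0' a0 cf).
have := itg_opp a0' cf; under eq_itg do rewrite ef.
by rewrite opprK oppr0 => ->; rewrite mulr_natl mulr2n.
Qed.

Lemma itg_period a p f : 0 < p -> continuous f -> (forall x, f (x + p) = f x) ->
  itg a (a + p) f = itg 0 p f.
Proof.
move=> p0 cf pf; have [G dG] := ex_primitive cf.
rewrite (@itg_primitive _ a _ f G)//; last by rewrite lerDl ltW.
rewrite (@itg_primitive _ 0 _ f G)//; last by rewrite ltW.
have := @is_derive_0_is_cst R (fun x => G (1 * x + p) - G x) a 0.
rewrite mulr0 add0r mul1r; apply => x.
have D := is_derive_aff (dG (1 * x + p)).
by apply: is_derive_eq; rewrite !mul1r pf subrr.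
Qed.

Lemma itg0 a b : itg a b (fun=> 0 : R) = 0.
Proof. by rewrite /itg Rintegral_cst//= mul0r. Qed.

Lemma itg_eq0 a b f : (forall x, a <= x <= b -> f x = 0) -> itg a b f = 0.
Proof. by move=> f0; rewrite (@eq_itg _ a b f (fun=> 0)) ?itg0. Qed.

Lemma itg_supp a b c d f : continuous f -> c <= a -> a <= b -> b <= d ->
  (forall x, ~~ (a < x < b) -> f x = 0) -> itg c d f = itg a b f.
Proof.
move=> cf ca ab bd f0; rewrite (itg_chasles ca (le_trans ab bd) cf).
rewrite (itg_chasles ab bd cf) (@itg_eq0 c a) ?(@itg_eq0 b d) ?add0r ?addr0//.
  by move=> x /andP[bx _]; apply: f0; rewrite negb_and -!leNgt bx orbT.
by move=> x /andP[_ xa]; apply: f0; rewrite negb_and -!leNgt xa.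
Qed.
End ChangeOfVariables.

Section LimitTheorems.
Context {R : realType}.
Implicit Types (f g : R -> R) (a b c d k h x y : R).
Local Notation mu := (@lebesgue_measure R).
Local Notation mR := (measurableTypeR R).

Lemma itg_dct a b (f_ : nat -> R -> R) f (K : R) :
    (forall n, continuous (f_ n)) ->
    (forall n x, a <= x <= b -> `|f_ n x| <= K) ->
    measurable_fun (setT : set R) f ->
    {ae mu, forall x, `[a, b]%classic x -> f_ n x @[n --> \oo] --> f x} ->
  mu.-integrable `[a, b] (EFin \o f) /\
  itg a b (f_ n) @[n --> \oo] --> itg a b f.
Proof.
move=> cf fK mf ff.
have [] := @dominated_convergence _ mR R mu `[a, b]%classic ltac:(by [])
    (fun n x => (f_ n x)%:E) (EFin \o f) (fun=> K%:E).
- by move=> n; apply/measurable_EFinP; apply: measurable_funTS; exact: cont_meas.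
- by apply/measurable_EFinP; exact: measurable_funTS.
- by apply: (@filterS _ _ (ae_filter_ringOfSetsType mu)) ff => x fx /fx h; apply: cvg_EFin => //; exact: nearW.
- exact: (cont_int a b (@contcst R K)).
- apply: aeW => x n; rewrite /= in_itv/= => xab.
  by rewrite lee_fin fK.
move=> fi _ fc; split=> //; apply: fine_cvg.
by rewrite /itg /Rintegral fineK; [exact: fc|exact: integrable_fin_num].
Qed.

Lemma itg_lim a b (f_ : nat -> R -> R) f (K : R) :
    (forall n, continuous (f_ n)) ->
    (forall n x, a <= x <= b -> `|f_ n x| <= K) ->
    (forall x, f_ n x @[n --> \oo] --> f x) ->
  mu.-integrable `[a, b] (EFin \o f) /\
  itg a b (f_ n) @[n --> \oo] --> itg a b f.
Proof.
move=> cf fK ff; apply: itg_dct fK _ _ => //.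
  by apply: measurable_fun_cvg => [n|x _]; [exact: cont_meas|exact: ff].
by apply: aeW => x _; exact: ff.
Qed.

Lemma itg_swap a b c d (k : R -> R -> R) (K : R) :
    (forall x, continuous (k x)) -> (forall y, continuous (k^~ y)) ->
    measurable_fun setT (fun p : mR * mR => k p.1 p.2) ->
    (forall x y, a <= x <= b -> c <= y <= d -> `|k x y| <= K) ->
    continuous (fun x => itg c d (k x)) -> continuous (fun y => itg a b (k^~ y)) ->
  itg a b (fun x => itg c d (k x)) = itg c d (fun y => itg a b (k^~ y)).
Proof.
move=> c1 c2 mk kK c3 c4.
pose A : set mR := `[a, b]%classic; pose B : set mR := `[c, d]%classic.
pose f (p : mR * mR) : \bar R := ((fun p : mR * mR => (k p.1 p.2)%:E) \_ (A `*` B)) p.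
have mA : measurable A by exact: measurable_itv.
have mB : measurable B by exact: measurable_itv.
have mAB : measurable (A `*` B) by exact: measurableX.
have fi : (mu \x mu)%E.-integrable setT f.
  apply/(integrable_mkcond (fun p : mR * mR => (k p.1 p.2)%:E) mAB).
  apply: (@measurable_bounded_integrable _ (mR * mR)%type R (mu \x mu)%E
    (fun p : mR * mR => k p.1 p.2)) => //.
  - have E := product_measure1E mu mu mA mB.
    have fA : (mu A < +oo)%E.
      by rewrite /A lebesgue_measure_itv/=; case: ifP => _; rewrite ?ltry// -EFinD ltry.
    have fB : (mu B < +oo)%E.
      by rewrite /B lebesgue_measure_itv/=; case: ifP => _; rewrite ?ltry// -EFinD ltry.
    by rewrite [X in (X < _)%E]E; apply: lte_mul_pinfty => //; rewrite ge0_fin_numE.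
  - exact: measurable_funTS.
  - exists K; split; first exact: num_real.
    move=> M KM [x y] [/= Ax By]; apply: ltW; apply: le_lt_trans KM.
    by apply: kK; rewrite /A /B /= in_itv/= in Ax By.
have := Fubini fi.
have E1 x y : f (x, y) = (if (x \in A) && (y \in B) then (k x y)%:E else 0)%E.
  by rewrite /f patchE in_setX.
have -> : (\int[mu]_x \int[mu]_y f (x, y) = (itg a b (fun x => itg c d (k x)))%:E)%E.
  rewrite /itg /Rintegral fineK; last exact: integrable_fin_num (cont_int a b c3).
  rewrite [RHS]integral_mkcond; apply: eq_integral => x _.
  rewrite [RHS]patchE; under [LHS]eq_integral => z _ do rewrite E1.
  rewrite -/A; case: (x \in A) => /=; last by rewrite integral0.
  rewrite fineK; last exact: integrable_fin_num (cont_int c d (c1 x)).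
  by rewrite [RHS]integral_mkcond; apply: eq_integral => y _; rewrite patchE.
have -> : (\int[mu]_y \int[mu]_x f (x, y) = (itg c d (fun y => itg a b (k^~ y)))%:E)%E.
  rewrite /itg /Rintegral fineK; last exact: integrable_fin_num (cont_int c d c4).
  rewrite [RHS]integral_mkcond; apply: eq_integral => y _.
  rewrite [RHS]patchE; under [LHS]eq_integral => z _ do rewrite E1.
  rewrite -/B; case: (y \in B) => /=; last first.
    by under [LHS]eq_integral => z _ do rewrite andbF; rewrite integral0.
  under [LHS]eq_integral => z _ do rewrite andbT.
  rewrite fineK; last exact: integrable_fin_num (cont_int a b (c2 y)).
  by rewrite [RHS]integral_mkcond; apply: eq_integral => x _; rewrite patchE.
by case.
Qed.

Lemma bounded_itv a b f : continuous f ->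
  exists K, forall x, a <= x <= b -> `|f x| <= K.
Proof.
move=> cf; have [ab|ba] := leP a b; last first.
  by exists 0 => x /andP[ax xb]; move: (le_lt_trans (le_trans ax xb) ba); rewrite ltxx.
have [c _ h] := EVT_max ab (continuous_subspaceT (cont_norm cf)).
by exists `|f c| => x xab; apply: h; rewrite in_itv.
Qed.

(** Riemann-Lebesgue: shifting the variable by half a period of the
oscillation changes its sign, so the integral is half of that of
[g y - g (y + h)] against the oscillation, and [h] tends to 0. *)
Lemma riemann_lebesgue g w x : continuous g -> 0 < w ->
    (forall y, ~~ (- 2^-1 < y < 2^-1) -> g y = 0) ->
  itg (- 2^-1) 2^-1 (fun y => g y * cos (w * (2 * n%:R + 1) * (x - y)))
    @[n --> \oo] --> 0.
Proof.
move=> cg w0 g0.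
pose lam (n : nat) := w * (2 * n%:R + 1).
have lam0 n : 0 < lam n by rewrite mulr_gt0// ltr_wpDl// mulr_ge0.
pose h n := pi / lam n.
have h0 n : 0 < h n by rewrite divr_gt0// pi_gt0.
have hc : h n @[n --> \oo] --> 0.
  apply: (@squeeze_cvgr _ _ _ _ (fun=> 0) (fun n => pi / w * harmonic n)).
  - apply: nearW => n; rewrite ltW//= /h /lam invfM mulrA ler_pM2l ?divr_gt0 ?pi_gt0//.
    have p : 0 < 2 * n%:R + 1 :> R by rewrite ltr_wpDl// mulr_ge0.
    rewrite /harmonic/= lef_pV2 ?posrE ?ltr0Sn//.
    by rewrite -natr1 lerD2r ler_peMl// ler1n.
  - exact: cvg_cst.
  - by rewrite -[X in _ --> X](mulr0 (pi / w)); apply: cvgMr; exact: cvg_harmonic.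
have [N Nh] : exists N, forall n, (N <= n)%N -> h n <= 1.
  have [N _ HN] := cvgr0_norm_lt h hc 1 ltr01.
  by exists N => n /HN /=; rewrite gtr0_norm //; exact: ltW.
have [K gK] : exists K, forall y, `|g y| <= K.
  have [K gK] := @bounded_itv (- 2^-1) 2^-1 g cg.
  exists (Num.max K 0) => y; rewrite le_max.
  have [yi|/g0->] := boolP (- 2^-1 < y < 2^-1); last by rewrite normr0 lexx orbT.
  by rewrite gK//; case/andP: yi => /ltW -> /ltW ->.
have itg2 (f : R -> R) : continuous f -> (forall y, ~~ (- 2^-1 < y < 2^-1) -> f y = 0) ->
   itg (- 2^-1) 2^-1 f = itg (-2) 2 f.
  by move=> cf f0; rewrite (@itg_supp _ (- 2^-1) 2^-1)//; lra.
have key n : (N <= n)%N ->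
  2 * itg (- 2^-1) 2^-1 (fun y => g y * cos (lam n * (x - y))) =
  itg (- 2) 2 (fun y => (g y - g (y + h n)) * cos (lam n * (x - y))).
  move=> /Nh hn1.
  have E : itg (- 2) 2 (fun y => g (y + h n) * cos (lam n * (x - y))) =
          - itg (- 2^-1) 2^-1 (fun y => g y * cos (lam n * (x - y))).
    rewrite (@eq_itg _ _ _ _ (fun y => (fun z => g z * cos (lam n * (x - z) + pi)) (y + h n))).
      rewrite (@itg_shift _ (-2) 2 (h n) (fun z => g z * cos (lam n * (x - z) + pi)));
        [|lra|by cont].
      rewrite (@itg_supp _ (- 2^-1) 2^-1); [|by cont|have := h0 n; lra|lra|have := h0 n; lra|].
        rewrite -itgN; last by cont.
        by apply: eq_itg => z _; rewrite cosDpi mulrN.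
      by move=> z /g0 ->; rewrite mul0r.
    move=> y _; rewrite /=; congr (_ * cos _).
    have -> : pi = lam n * h n by rewrite /h mulrCA divff ?mulr1// gt_eqF.
    by ring.
  under [RHS]eq_itg do rewrite mulrBl.
  rewrite itgB; [|by cont|by cont].
  rewrite E opprK itg2; [by ring|by cont|].
  by move=> y /g0 ->; rewrite mul0r.
have gh y : `|g y - g (y + h n)| @[n --> \oo] --> 0.
  have hy : y + h n @[n --> \oo] --> y.
    by rewrite -[X in _ --> X]addr0; apply: cvgD => //; exact: cvg_cst.
  have gy : g y - g (y + h n) @[n --> \oo] --> g y - g y.
    apply: cvgB; first exact: cvg_cst.
    by apply: (continuous_cvg _ _ hy); exact: cg.
  by have := cvg_norm gy; rewrite subrr normr0; apply.
have ch n : continuous (fun y => `|g y - g (y + h n)|) by cont.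
have bh n y : -2 <= y <= 2 -> `| `|g y - g (y + h n)| | <= K + K.
  by move=> _; rewrite normr_id (le_trans (ler_normB _ _))// lerD.
have [_ lim0] := itg_lim ch bh gh.
rewrite itg0 in lim0.
apply/cvgr0Pnorm_le => e e0.
have [M _ HM] := cvgr0_norm_le _ lim0 e e0.
exists (maxn N M) => // n /=; rewrite geq_max => /andP[Nn Mn].
have := HM n Mn; rewrite /= => He.
have := key n Nn; rewrite -/(lam n) => E.
have : `|2 * itg (- 2^-1) 2^-1 (fun y => g y * cos (lam n * (x - y)))| <= e.
  rewrite E; apply: le_trans (le_trans (ler_norm _) He).
  apply: itg_le_norm; [by cont|by cont|] => y _.
  by rewrite normrM ler_piMr// ler_norml cos_geN1 cos_le1.
by rewrite normrM ger0_norm//; have := normr_ge0 (itg (- 2^-1) 2^-1 (fun y : R => g y * cos (lam n * (x - y)))); lra.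
Qed.
End LimitTheorems.

(** * The kernels of the circle and of the line *)

Section Kernels.
Context {R : realType}.
Implicit Types (u v x y c l : R).

(** The kernels [cot v] and [1 / sin v] without their pole at 0. Inverses of 0
being 0, both take at 0 the value 0 of their continuous extensions. *)
Definition cot_rem v : R := cos v / sin v - v^-1.
Definition csc_rem v : R := (sin v)^-1 - v^-1.

Lemma sin_neq0 v : - pi < v < pi -> v != 0 -> sin v != 0.
Proof.
move=> /andP[v1 v2]; rewrite neq_lt => /orP[v0|v0].
  by rewrite -(opprK v) sinN oppr_eq0 gt_eqF// sin_gt0_pi// oppr_gt0 v0 ltrNl.
by rewrite gt_eqF// sin_gt0_pi// v0.
Qed.

Lemma sin_le v : 0 <= v -> sin v <= v.
Proof.
move=> v0; have [c _] := @MVT_segment R sin cos 0 v v0 (fun x _ => is_derive_sin x)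
  (continuous_subspaceT (@continuous_sin R)).
by rewrite sin0 !subr0 => ->; rewrite ler_piMl// cos_le1.
Qed.

Lemma cos_ge v : 0 <= v -> 1 - cos v <= v ^+ 2.
Proof.
move=> v0; have [c] := @MVT_segment R cos (fun x => - sin x) 0 v v0 (fun x _ => is_derive_cos x)
  (continuous_subspaceT (@continuous_cos R)).
rewrite in_itv/= => /andP[c0 cv]; rewrite cos0 subr0 => /eqP; rewrite subr_eq => /eqP ->.
by have := sin_le c0; nra.
Qed.

Lemma sin_near0 v : 0 <= v -> v <= 2^-1 ->
  [/\ 2^-1 * v <= sin v, v - sin v <= v ^+ 3 & `|v * cos v - sin v| <= v ^+ 3].
Proof.
move=> v0 v2; have [c] := @MVT_segment R sin cos 0 v v0 (fun x _ => is_derive_sin x)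
  (continuous_subspaceT (@continuous_sin R)).
rewrite in_itv/= => /andP[c0 cv]; rewrite sin0 !subr0 => ->.
have c1 := cos_ge c0; have c2 := cos_le1 c; have c3 := cos_ge v0; have c4 := cos_le1 v.
have c5 : 1 - cos c <= v ^+ 2 by nra.
split; [nra|nra|].
by rewrite -mulrC -mulrBl normrM (ger0_norm v0) exprSr ler_wpM2r// ler_norml; nra.
Qed.

Lemma rem_near0 v : `|v| <= 2^-1 -> `|cot_rem v| <= 2 * `|v| /\ `|csc_rem v| <= 2 * `|v|.
Proof.
wlog v0 : v / 0 <= v => [W|].
  have [|v0] := leP 0 v; first exact: W.
  rewrite -normrN => h; have [|h1 h2] := W (- v) _ h; first by rewrite oppr_ge0 ltW.
  rewrite -(normrN (cot_rem v)) -(normrN (csc_rem v)).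
  have -> : - cot_rem v = cot_rem (- v) by rewrite /cot_rem cosN sinN !invrN mulrN opprD.
  by have -> : - csc_rem v = csc_rem (- v) by rewrite /csc_rem sinN !invrN opprD.
rewrite (ger0_norm v0) => v2.
have [->|vn0] := eqVneq v 0.
  by rewrite /cot_rem /csc_rem sin0 invr0 mulr0 subr0 normr0 mulr0.
have vp : 0 < v by rewrite lt_neqAle eq_sym vn0.
have [s1 s2 s3] := sin_near0 v0 v2.
have sp : 0 < sin v by nra.
have sn0 : sin v != 0 by rewrite gt_eqF.
have E1 : cot_rem v = (v * cos v - sin v) / (v * sin v).
  by rewrite /cot_rem; field; rewrite ?vn0 ?sn0.
have E2 : csc_rem v = (v - sin v) / (v * sin v).
  by rewrite /csc_rem; field; rewrite ?vn0 ?sn0.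
have s4 : 0 <= v - sin v by rewrite subr_ge0 sin_le.
have p : 0 < v * sin v by rewrite mulr_gt0.
have q : v ^+ 3 <= 2 * v * (v * sin v).
  have -> : 2 * v * (v * sin v) = v ^+ 2 * (2 * sin v) by ring.
  by rewrite exprSr ler_wpM2l ?sqr_ge0//; lra.
rewrite E1 E2 !normrM !normfV (gtr0_norm p) !ler_pdivrMr// (ger0_norm s4).
by split; [exact: le_trans s3 q|exact: le_trans s2 q].
Qed.

Lemma rem_cont v : - pi < v < pi ->
  {for v, continuous cot_rem} /\ {for v, continuous csc_rem}.
Proof.
move=> vpi; have [->|v0] := eqVneq v 0; last first.
  have s0 := sin_neq0 vpi v0.
  split.
    apply: cvgB; last by apply: continuousV => //; exact: cvg_id.
    by apply: cvgM; [exact: continuous_cos|apply: continuousV => //; exact: continuous_sin].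
  apply: cvgB; last by apply: continuousV => //; exact: cvg_id.
  by apply: continuousV => //; exact: continuous_sin.
have H (f : R -> R) : (forall v, `|v| <= 2^-1 -> `|f v| <= 2 * `|v|) -> {for 0, continuous f}.
  move=> h; have f0 : f 0 = 0.
    by apply/eqP; rewrite -normr_le0; have := h 0; rewrite normr0 mulr0; apply; lra.
  rewrite /prop_for /continuous_at f0; apply/cvgr0Pnorm_le => e e0.
  exists (Num.min 2^-1 (e / 2)) => /=; first by rewrite lt_min; apply/andP; split; lra.
  move=> y /=; rewrite sub0r normrN lt_min => /andP[/ltW /h y1 y2].
  by apply: le_trans y1 _; lra.
by split; apply: H => w /rem_near0 [].
Qed.

(** For an odd function the sign of the derivative is only required on the right
of 0, and continuity at 0 joins the two halves. *)
Lemma odd_nonincreasing (k d : R -> R) c : (forall x, k (- x) = - k x) ->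
  (forall x, 0 <= x < c -> {for x, continuous k}) ->
  (forall x, 0 < x < c -> is_derive x 1 k (d x)) ->
  (forall x, 0 < x < c -> d x <= 0) ->
  forall x y, - c < x -> x <= y -> y < c -> k y <= k x.
Proof.
move=> ok ck dk d0.
have k0 : k 0 = 0.
  by have := ok 0; rewrite oppr0 => /eqP; rewrite -addr_eq0 -mulr2n mulrn_eq0 => /eqP.
have P x y : 0 <= x -> x <= y -> y < c -> k y <= k x.
  move=> x0; rewrite le_eqVlt => /predU1P[->//|xy] yc.
  have [z||z] := @MVT R k d x y xy.
  - by rewrite in_itv/= => /andP[xz zy]; apply: dk; rewrite (le_lt_trans x0 xz) (lt_trans zy yc).
  - apply: continuous_in_subspaceT => z; rewrite inE/= in_itv/= => /andP[xz zy].
    by apply: ck; rewrite (le_trans x0 xz) (le_lt_trans zy yc).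
  rewrite in_itv/= => /andP[xz zy] E.
  have : d z <= 0 by apply: d0; rewrite (le_lt_trans x0 xz) (lt_trans zy yc).
  by move=> dz; rewrite -subr_le0 E mulr_le0_ge0// subr_ge0 ltW.
move=> x y cx xy yc; have [x0|x0] := leP 0 x; first exact: P.
have xc : - x < c by rewrite ltrNl.
have [y0|y0] := leP 0 y.
  apply: (@le_trans _ _ 0); first by rewrite -k0; apply: P.
  by rewrite -(opprK x) ok oppr_ge0 -k0; apply: P => //; rewrite oppr_ge0 ltW.
rewrite -(opprK x) -(opprK y) !(ok (- _)) lerN2.
by apply: P => //; [rewrite oppr_ge0 ltW|rewrite lerN2].
Qed.

Lemma cot_remN v : cot_rem (- v) = - cot_rem v.
Proof. by rewrite /cot_rem cosN sinN !invrN mulrN opprD. Qed.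

Lemma is_derive_cot_rem v : 0 < v < pi ->
  is_derive v 1 cot_rem (v ^- 2 - sin v ^- 2).
Proof.
move=> /andP[v0 vpi]; have s0 : sin v != 0 by rewrite gt_eqF// sin_gt0_pi// v0.
have vn0 : v != 0 by rewrite gt_eqF.
rewrite /cot_rem.
have D1 : is_derive v 1 (fun x : R => (sin x)^-1) (- sin v ^- 2 *: cos v).
  by apply: is_deriveV.
have D2 : is_derive v 1 (fun x : R => x^-1) (- v ^- 2 *: 1).
  by apply: (@is_deriveV R id).
apply: is_derive_eq.
rewrite /GRing.scale/=.
have c2 := cos2Dsin2 v.
have -> : cos v * (- sin v ^- 2 * cos v) + (sin v)^-1 * - sin v - - v ^- 2 * 1 =
   v ^- 2 - (cos v ^+ 2 + sin v ^+ 2) / sin v ^+ 2 by field; rewrite ?vn0 ?s0.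
by rewrite c2 div1r.
Qed.
End Kernels.

Section KernelMonotonicity.
Context {R : realType}.
Implicit Types (u v x y c l : R).

(** The derivative is [v^-2 - (sin v)^-2], and [sin v <= v]. *)
Lemma cot_rem_nonincreasing x y : - pi < x -> x <= y -> y < pi ->
  cot_rem y <= cot_rem x.
Proof.
apply: (@odd_nonincreasing _ cot_rem (fun v => v ^- 2 - sin v ^- 2)).
- exact: cot_remN.
- move=> v /andP[v0 vpi]; apply: (rem_cont _).1.
  by rewrite vpi (lt_le_trans _ v0)// oppr_lt0 pi_gt0.
- exact: is_derive_cot_rem.
- move=> v /andP[v0 vpi]; rewrite subr_le0.
  have s0 : 0 < sin v by rewrite sin_gt0_pi// v0.
  by rewrite lef_pV2 ?posrE ?exprn_gt0// ler_pXn2r ?nnegrE ?(ltW v0) ?(ltW s0)// sin_le// ltW.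
Qed.

(** The difference vanishes at 0, and its derivative [cos (w / l) - cos w] is
nonnegative, the cosine being decreasing on [0, pi]. *)
Lemma sin_scale l w : 1 <= l -> 0 <= w <= pi -> sin w <= l * sin (l^-1 * w).
Proof.
move=> l1 /andP[w0 wpi]; have lp : 0 < l by apply: lt_le_trans l1.
have V x : is_derive x 1 (fun x : R => l * sin (l^-1 * x + 0) - sin x) (cos (l^-1 * x + 0) - cos x).
  have D := is_derive_aff (is_derive_sin (l^-1 * x + 0)).
  by apply: is_derive_eq; rewrite /GRing.scale/= mulVKf// gt_eqF.
have [c] := @MVT_segment R _ _ 0 w w0 (fun x _ => V x)
  (continuous_subspaceT (derivable_cont V)).
rewrite in_itv/= => /andP[c0 cw].
rewrite !addr0 mulr0 sin0 mulr0 !subr0 => E.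
rewrite -subr_ge0 E mulr_ge0// subr_ge0.
have c1 : l^-1 * c <= c by rewrite ler_piMl// invf_le1.
have c2 : 0 <= l^-1 * c by rewrite mulr_ge0// invr_ge0 ltW.
have c3 : c <= pi by apply: le_trans wpi.
move: (c1); rewrite le_eqVlt => /predU1P[->//|c4].
by rewrite ltW// ltr_cos// in_itv/= ?c0 ?c2 ?c3// (le_trans c1).
Qed.

(** The poles cancel, so that this function is the difference of the kernels of
the circles of length 1 and [l]; its derivative is
[pi ((l sin (pi v / l))^-2 - (sin (pi v))^-2)], of the sign given by
[sin_scale]. *)
Lemma cot_diff_nonincreasing l x y : 1 <= l -> - 1 < x -> x <= y -> y < 1 ->
  cot_rem (pi * y) - l^-1 * cot_rem (pi / l * y) <=
  cot_rem (pi * x) - l^-1 * cot_rem (pi / l * x).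
Proof.
move=> l1; have lp : 0 < l by apply: lt_le_trans l1.
have pp := @pi_gt0 R.
have bd v : 0 < v < 1 -> 0 < pi * v < pi /\ 0 < pi / l * v < pi.
  move=> /andP[v0 v1]; rewrite !mulr_gt0 ?invr_gt0//= gtr_pMr// v1; split=> //.
  by rewrite -mulrA gtr_pMr// mulrC ltr_pdivrMr// mul1r (lt_le_trans v1).
apply: (@odd_nonincreasing _ (fun u => cot_rem (pi * u) - l^-1 * cot_rem (pi / l * u))
  (fun u => pi * ((pi * u) ^- 2 - sin (pi * u) ^- 2) -
     l^-1 * (pi / l * ((pi / l * u) ^- 2 - sin (pi / l * u) ^- 2)))).
- by move=> v; rewrite !mulrN !cot_remN mulrN; ring.
- move=> v /andP[v0 v1].
  have C k : - pi < k * v < pi -> {for v, continuous (fun u => cot_rem (k * u))}.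
    move=> /rem_cont[h _]; apply: (@continuous_comp _ _ _ (fun u => k * u) cot_rem) => //.
    by apply: contM; [exact: contcst|exact: contid].
  have p1 : - pi < pi * v < pi.
    by rewrite gtr_pMr// v1 andbT (lt_le_trans (y:=0))// ?oppr_lt0// mulr_ge0// ltW.
  have p2 : - pi < pi / l * v < pi.
    apply/andP; split.
      by apply: (@lt_le_trans _ _ 0); rewrite ?oppr_lt0// mulr_ge0// divr_ge0// ltW.
    by rewrite -mulrA gtr_pMr// mulrC ltr_pdivrMr// mul1r (lt_le_trans v1).
  have C2 : l^-1 * cot_rem (pi / l * u) @[u --> v] --> l^-1 * cot_rem (pi / l * v).
    by apply: cvgM; [exact: cvg_cst|exact: (C _ p2)].
  exact: cvgB (C _ p1) C2.
- move=> v /bd[b1 b2].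
  have b1' : 0 < pi * v + 0 < pi by rewrite addr0.
  have b2' : 0 < pi / l * v + 0 < pi by rewrite addr0.
  have D1 := is_derive_aff (is_derive_cot_rem b1').
  have D2 := is_derive_aff (is_derive_cot_rem b2').
  rewrite (_ : (fun u => _) = (fun u => cot_rem (pi * u + 0) - l^-1 * cot_rem (pi / l * u + 0))).
    by apply: is_derive_eq; rewrite /GRing.scale/= !addr0.
  by apply/funext => u; rewrite !addr0.
- move=> v /[dup] /bd[/andP[b1 b2] /andP[b3 b4]] /andP[v0 v1].
  have s1 : 0 < sin (pi * v) by rewrite sin_gt0_pi// b1.
  have s2 : 0 < sin (pi / l * v) by rewrite sin_gt0_pi// b3.
  have := @sin_scale l (pi * v) l1 ltac:(by rewrite (ltW b1) (ltW b2)).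
  rewrite mulrA [l^-1 * pi]mulrC => h.
  have -> : pi * ((pi * v) ^- 2 - sin (pi * v) ^- 2) -
     l^-1 * (pi / l * ((pi / l * v) ^- 2 - sin (pi / l * v) ^- 2)) =
     pi * ((l * sin (pi / l * v)) ^- 2 - sin (pi * v) ^- 2).
    move: s1 s2 pp; move: (sin (pi * v)) (sin (pi / l * v)) (pi : R) => s s' p s1 s2 pp.
    by field; rewrite (gt_eqF s1) (gt_eqF s2) (gt_eqF lp) (gt_eqF v0) (gt_eqF pp).
  rewrite pmulr_rle0// subr_le0 lef_pV2 ?posrE ?exprn_gt0 ?mulr_gt0//.
  by apply: lerXn2r => //; rewrite nnegrE ?mulr_ge0 ?(ltW s1) ?(ltW s2) ?(ltW lp).
Qed.

(** [cot_rem] and [csc_rem] have poles at the nonzero multiples of [pi]; composed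
with [clamp c] for [c < pi] they become continuous on the whole line, and keep
their values on [[-c, c]]. *)
Definition clamp c v : R := Num.max (- c) (Num.min c v).

Lemma clamp_id c v : `|v| <= c -> clamp c v = v.
Proof. by rewrite ler_norml /clamp => /andP[c1 c2]; rewrite min_r// max_r. Qed.

Lemma clamp_bd c v : 0 <= c -> c < pi -> - pi < clamp c v < pi.
Proof.
move=> c0 cpi; rewrite /clamp lt_max ltrN2 cpi/= gt_max gt_min cpi/= andbT.
by rewrite (le_lt_trans _ (pi_gt0 R))// oppr_le0.
Qed.

Lemma clamp_cont c : continuous (clamp c).
Proof. by rewrite /clamp; cont. Qed.

Lemma rem_clamp_cont c : 0 <= c -> c < pi ->
  continuous (cot_rem \o clamp c) /\ continuous (csc_rem \o clamp c).
Proof.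
move=> c0 cpi; split=> v; (apply: continuous_comp; first exact: clamp_cont).
  exact: (rem_cont (clamp_bd v c0 cpi)).1.
exact: (rem_cont (clamp_bd v c0 cpi)).2.
Qed.

Lemma rem_bounded c : c < pi -> exists K, forall v, `|v| <= c ->
  `|cot_rem v| <= K /\ `|csc_rem v| <= K.
Proof.
move=> cpi; have [c0|c0] := leP 0 c; last first.
  by exists 0 => v vc; have := normr_ge0 v; rewrite leNgt (le_lt_trans vc).
have [c1 c2] := rem_clamp_cont c0 cpi.
have [K1 h1] := @bounded_itv R (- c) c _ c1.
have [K2 h2] := @bounded_itv R (- c) c _ c2.
exists (Num.max K1 K2) => v vc; rewrite !le_max.
move: (h1 v) (h2 v); rewrite /= clamp_id// -ler_norml vc.
by move=> /(_ isT)-> /(_ isT)->; rewrite orbT.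
Qed.
End KernelMonotonicity.

(** * Partial sums of conjugate Fourier series *)

Section ConjugateSeries.
Context {R : realType}.
Implicit Types (u v x y t c l : R).
Local Notation mR := (measurableTypeR R).

Lemma cont_param a b (k : R -> R -> R) (K : R) :
  (forall x, continuous (k x)) -> (forall y, continuous (k^~ y)) ->
  (forall x y, a <= y <= b -> `|k x y| <= K) ->
  continuous (fun x => itg a b (k x)).
Proof.
move=> c1 c2 kK x; apply/(@cvg_nbhsP _ R^o) => w wx.
apply: (itg_lim (K := K) (fun n => c1 (w n)) _ _).2 => [n y|y]; first exact: kK.
by apply: (@continuous_cvg _ _ _ _ _ w (k^~ y) x _ wx); exact: c2.
Qed.

Variable F : R -> R.
Hypothesis Fcont : continuous F.
Hypothesis Feven : forall x, F (- x) = F x.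
Hypothesis Fsupp : forall y, ~~ (- 2^-1 < y < 2^-1) -> F y = 0.

Local Notation IF g := (itg (- 2^-1) 2^-1 g).

(** The Fourier transform of [F], as [F] is even. *)
Definition cosT t : R := IF (fun y => F y * cos (2 * pi * (t * y))).

Lemma F_bounded : exists2 K, 0 <= K & forall y, `|F y| <= K.
Proof.
have [K FK] := @bounded_itv R (- 2^-1) 2^-1 F Fcont.
exists (Num.max K 0) => [|y]; first by rewrite le_max lexx orbT.
rewrite le_max; have [yi|/Fsupp->] := boolP (- 2^-1 < y < 2^-1); last first.
  by rewrite normr0 lexx orbT.
by rewrite FK//; case/andP: yi => /ltW -> /ltW ->.
Qed.

Lemma cosT_cont : continuous cosT.
Proof.
have [K K0 FK] := F_bounded.
apply: (@cont_param _ _ (fun t y => F y * cos (2 * pi * (t * y))) K) => [t|y|t y _].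
- by cont.
- by cont.
by rewrite normrM (le_trans _ (FK y))// ler_piMr// ler_norml cos_geN1 cos_le1.
Qed.

Lemma cosT_sin t x :
  cosT t * sin (2 * pi * (t * x)) = IF (fun y => F y * sin (2 * pi * (t * (x - y)))).
Proof.
have c1 : continuous (fun y => F y * cos (2 * pi * (t * y))) by cont.
have c2 : continuous (fun y => F y * sin (2 * pi * (t * y))) by cont.
have o0 : IF (fun y => F y * sin (2 * pi * (t * y))) = 0.
  by apply: itg_odd => // y; rewrite Feven !mulrN sinN mulrN.
rewrite /cosT mulrC -itgZ// -[LHS]subr0 -[X in _ - X](mulr0 (cos (2 * pi * (t * x)))).
rewrite -o0 -itgZ// -itgB//; [|by cont|by cont].
by apply: eq_itg => y _; rewrite !mulrBr sinB; ring.
Qed.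

(** Fubini turns the truncated inversion integral of the Hilbert transform on the
line into a convolution, like a partial sum of a conjugate series, so that the
two can be compared kernel by kernel. *)
Lemma truncated_hilbert_kernel r x :
  2 * itg 0 r (fun t => cosT t * sin (2 * pi * (t * x))) =
  IF (fun y => F y * (2 * itg 0 r (fun t => sin (2 * pi * (t * (x - y)))))).
Proof.
have [K K0 FK] := F_bounded.
pose k t y := F y * sin (2 * pi * (t * (x - y))).
have kK t y : `|k t y| <= K.
  by rewrite normrM (le_trans _ (FK y))// ler_piMr// ler_norml sin_geN1 sin_le1.
have c1 t : continuous (k t) by rewrite /k; cont.
have c2 y : continuous (k^~ y) by rewrite /k; cont.
have mk : measurable_fun setT (fun p : mR * mR => k p.1 p.2).
  apply: measurable_funM.
    by apply: (measurableT_comp (cont_meas Fcont)).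
  apply: (measurableT_comp (cont_meas (@continuous_sin R))).
  apply: measurable_funM => //; apply: measurable_funM => //.
  exact: measurable_funB.
have cp1 : continuous (fun t => IF (k t)) by exact: (@cont_param _ _ _ K).
have cp2 : continuous (fun y => itg 0 r (k^~ y)).
  exact: (@cont_param _ _ (fun y t => k t y) K).
have -> : itg 0 r (fun t => cosT t * sin (2 * pi * (t * x))) = itg 0 r (fun t => IF (k t)).
  by apply: eq_itg => t _; exact: cosT_sin.
rewrite (@itg_swap R 0 r (- 2^-1) 2^-1 k K)//.
rewrite -itgZ//; apply: eq_itg => y _.
rewrite /k itgZ; first by ring.
by cont.
Qed.

Lemma itg_sin r u : 0 <= r ->
  itg 0 r (fun t => sin (2 * pi * (t * u))) = (1 - cos (2 * pi * (r * u))) / (2 * pi * u).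
Proof.
move=> r0; have [->|u0] := eqVneq u 0.
  rewrite !mulr0 invr0 mulr0; apply: itg_eq0 => t _.
  by rewrite !mulr0 sin0.
have p0 : 2 * pi * u != 0 by rewrite !mulf_neq0// gt_eqF// pi_gt0.
pose G t := - (2 * pi * u)^-1 * cos (2 * pi * u * t + 0).
have dG t : is_derive t 1 G (sin (2 * pi * (t * u))).
  have D := is_derive_aff (is_derive_cos (2 * pi * u * t + 0)).
  apply: is_derive_eq; rewrite /GRing.scale/=.
  rewrite mulNr !mulrN opprK mulKf// addr0; congr sin; ring.
rewrite (@itg_primitive R 0 r _ G)//; last by cont.
rewrite /G mulr0 !addr0 cos0 mulr1 (_ : 2 * pi * u * r = 2 * pi * (r * u)); last by ring.
by rewrite mulNr opprK addrC mulrBl mul1r [_^-1 * _]mulrC.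
Qed.

(** The conjugate Dirichlet kernel in closed form; multiplying out avoids the
zeros of [sin v]. *)
Lemma conj_dirichlet n v :
  2 * (\sum_(i < n) sin (2 * i.+1%:R * v)) * sin v = cos v - cos ((2 * n%:R + 1) * v).
Proof.
elim: n => [|n IH]; first by rewrite big_ord0 !mulr0 add0r mul1r subrr mul0r.
rewrite big_ord_recr/= mulrDr mulrDl IH.
have -> : (2 * n.+1%:R + 1) * v = 2 * n.+1%:R * v + v by ring.
have -> : (2 * n%:R + 1) * v = 2 * n.+1%:R * v - v by rewrite -natr1; ring.
by rewrite !cosD cosN sinN; ring.
Qed.

(** The partial sum of the conjugate Fourier series of the [l]-periodization
of [F]. *)
Definition conj_sum l n x : R :=
  2 / l * \sum_(i < n) cosT (i.+1%:R / l) * sin (2 * pi * (i.+1%:R / l * x)).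

Lemma conj_sum_cont l n : continuous (conj_sum l n).
Proof. by rewrite /conj_sum; cont. Qed.

Lemma conj_sum_kernel l n x : conj_sum l n x =
  IF (fun y => F y * (2 / l * \sum_(i < n) sin (2 * pi * (i.+1%:R / l * (x - y))))).
Proof.
rewrite /conj_sum; under eq_bigr do rewrite cosT_sin.
rewrite -itg_sum; last by move=> i; cont.
rewrite -itgZ; last by cont.
apply: eq_itg => y _; rewrite mulrCA; congr (_ * _).
by rewrite mulr_sumr.
Qed.

(** The conjugate Dirichlet kernel of the circle of length [l] is the truncated
kernel of the line at the frequency [(2 n + 1) / (2 l)], plus a fixed continuous
function, minus a continuous function times an oscillation. The frequency is the
half-integer one, for which the two closed forms contain the same cosine. *)
Lemma dirichlet_split l n u : 0 < l -> `|u| < l ->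
  2 / l * \sum_(i < n) sin (2 * pi * (i.+1%:R / l * u)) =
  2 * itg 0 ((2 * n%:R + 1) / (2 * l)) (fun t => sin (2 * pi * (t * u))) +
  l^-1 * cot_rem (pi / l * u) -
  l^-1 * (csc_rem (pi / l * u) * cos (pi / l * (2 * n%:R + 1) * u)).
Proof.
move=> l0 ul; have pp := @pi_gt0 R.
rewrite itg_sin; last by rewrite divr_ge0// ?mulr_ge0 ?addr_ge0 ?ltW.
pose v := pi / l * u; have E (i : 'I_n) : 2 * pi * (i.+1%:R / l * u) = 2 * i.+1%:R * v.
  by rewrite /v; ring.
under eq_bigr do rewrite E.
rewrite (_ : 2 * pi * ((2 * n%:R + 1) / (2 * l) * u) = (2 * n%:R + 1) * v); last first.
  by rewrite /v; field; rewrite gt_eqF.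
rewrite (_ : pi / l * (2 * n%:R + 1) * u = (2 * n%:R + 1) * v); last by rewrite /v; ring.
rewrite -/v; have [u0|u0] := eqVneq u 0.
  rewrite /v u0 !mulr0 /cot_rem /csc_rem sin0 !invr0 !mulr0 subr0 mul0r !mulr0 subr0 addr0.
  by rewrite big1 ?mulr0// => i _; rewrite mulr0 sin0.
have v0 : v != 0 by rewrite /v mulf_neq0// gt_eqF// divr_gt0.
have vpi : - pi < v < pi.
  rewrite -ltr_norml /v normrM gtr0_norm ?divr_gt0//.
  by rewrite -mulrA gtr_pMr// mulrC ltr_pdivrMr// mul1r.
have s0 := sin_neq0 vpi v0.
have -> : \sum_(i < n) sin (2 * i.+1%:R * v) =
   (cos v - cos ((2 * n%:R + 1) * v)) / (2 * sin v).
  by rewrite -conj_dirichlet; field.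
rewrite /cot_rem /csc_rem.
have -> : u = v * l / pi.
  by rewrite /v; move: (pi : R) pp => p pp; field; rewrite !gt_eqF.
move: (cos v) (cos _) (sin v) s0 => c1 c2 s s0.
move: (v) v0 (pi : R) pp => w w0 p pp; field; rewrite s0 w0 !gt_eqF//=.
Qed.
End ConjugateSeries.

Section ConjugateLimit.
Context {R : realType}.
Implicit Types (u v x y t c l : R).
Local Notation mu := (@lebesgue_measure R).
Local Notation IF g := (itg (- 2^-1) 2^-1 g).

Variable F : R -> R.
Hypothesis Fcont : continuous F.
Hypothesis Feven : forall x, F (- x) = F x.
Hypothesis Fsupp : forall y, ~~ (- 2^-1 < y < 2^-1) -> F y = 0.
Hypothesis Fint : mu.-integrable setT (EFin \o cosT F).

Let A := cosT F.
Let Acont : continuous A. Proof. exact: cosT_cont. Qed.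

(** The Hilbert transform on the line: [F] being even, only the odd part of
[e(t x)] contributes, and [sgn t sin (t x) = sin (|t| x)]. *)
Definition hilbertL x : R := (\int[mu]_t (A t * sin (2 * pi * (`|t| * x))))%R.

Lemma cosT_even t : A (- t) = A t.
Proof.
by rewrite /A /cosT; apply: eq_itg => y _; rewrite mulNr mulrN cosN.
Qed.

Lemma trunc_even r x : 0 <= r ->
  2 * itg 0 r (fun t => A t * sin (2 * pi * (t * x))) =
  itg (- r) r (fun t => A t * sin (2 * pi * (`|t| * x))).
Proof.
move=> r0; rewrite itg_even//; last by move=> t; rewrite cosT_even normrN.
  by congr (2 * _); apply: eq_itg => t /andP[t0 _]; rewrite ger0_norm.
by cont.
Qed.

Lemma trunc_cvg (r_ : nat -> R) x : (forall n, 0 <= r_ n) -> r_ n @[n --> \oo] --> +oo ->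
  2 * itg 0 (r_ n) (fun t => A t * sin (2 * pi * (t * x))) @[n --> \oo] --> hilbertL x.
Proof.
move=> r0 roo; under eq_fun do rewrite trunc_even//.
pose f t := A t * sin (2 * pi * (`|t| * x)).
have cf : continuous f by rewrite /f; cont.
have [] := @dominated_convergence _ (measurableTypeR R) R mu setT ltac:(by [])
  (fun n => (EFin \o f) \_ `[- r_ n, r_ n]) (EFin \o f) (fun t => `|A t|%:E).
- move=> n; apply/(measurable_restrictT _ _).1 => //.
  by apply/measurable_EFinP; apply: measurable_funTS; exact: cont_meas.
- by apply/measurable_EFinP; exact: cont_meas.
- apply: aeW => t _; have [N _ HN] := (cvgryPge _).1 roo `|t|.
  apply: cvg_near_cst; exists N => // n /HN /= tn.
  by rewrite patchE mem_set// /= in_itv/= -ler_norml.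
- exact: integrable_abse Fint.
- apply: aeW => t n _; rewrite patchE; case: ifPn => _; last by rewrite abse0 lee_fin.
  by rewrite lee_fin normrM ler_piMr// ler_norml sin_geN1 sin_le1.
move=> fi _ fc; apply: fine_cvg.
rewrite /hilbertL /Rintegral fineK; last exact: integrable_fin_num fi.
have E : (fun n => (\int[mu]_(t in `[(- r_ n)%R, r_ n]) (f t)%:E)%E) =
         (fun n => (\int[mu]_t (((EFin \o f) \_ `[(- r_ n)%R, r_ n]) t))%E).
  by apply/funext => n; rewrite integral_mkcond.
have := fc; rewrite /= -E; exact.
Qed.

Lemma trunc_bound : exists K, forall r x, 0 <= r ->
  `|2 * itg 0 r (fun t => A t * sin (2 * pi * (t * x)))| <= K.
Proof.
exists (\int[mu]_t `|A t|)%R => r x r0; rewrite trunc_even//.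
apply: (@le_trans _ _ (itg (- r) r (fun t => `|A t|))).
  apply: itg_le_norm; [by cont|by cont|] => t _.
  by rewrite normrM ler_piMr// ler_norml sin_geN1 sin_le1.
rewrite /itg /Rintegral fine_le//.
- by apply: integrable_fin_num => //; apply: cont_int; cont.
- by apply: integrable_fin_num => //; exact: integrable_abse Fint.
apply: ge0_subset_integral => //.
by apply/measurable_EFinP; apply: cont_meas; cont.
Qed.

Section Period.
Variable l : R.
Hypothesis l0 : 0 < l.

Let r_ (n : nat) : R := (2 * n%:R + 1) / (2 * l).

Let r_ge0 n : 0 <= r_ n.
Proof. by rewrite /r_ divr_ge0// ?mulr_ge0 ?addr_ge0 ?ltW. Qed.

Let r_oo : r_ n @[n --> \oo] --> +oo.
Proof.
apply/cvgryPge => a.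
have [N _ HN] := (cvgryPge _).1 (@cvgr_idn R) (a * l).
exists N => // n /HN /= h.
by rewrite /r_ ler_pdivlMr ?mulr_gt0// ?ltr0n//; nra.
Qed.

Let cr c v := cot_rem (clamp c v).
Let sr c v := csc_rem (clamp c v).

(** [dirichlet_split] integrated against [F]. For [y] in the support of [F] the
argument [pi / l * (x - y)] stays in [[-c, c]], where clamping changes
nothing. *)
Lemma conj_sum_split c n x : c < pi -> pi / l * (`|x| + 2^-1) <= c ->
  [/\ continuous (fun y => F y * cr c (pi / l * (x - y))),
    continuous (fun y => F y * sr c (pi / l * (x - y))) &
  conj_sum F l n x = 2 * itg 0 (r_ n) (fun t => A t * sin (2 * pi * (t * x))) +
    l^-1 * IF (fun y => F y * cr c (pi / l * (x - y))) -
    l^-1 * IF (fun y => F y * sr c (pi / l * (x - y)) *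
                        cos (pi / l * (2 * n%:R + 1) * (x - y)))].
Proof.
move=> cpi xc; have pl : 0 < pi / l by rewrite divr_gt0// pi_gt0.
have c0 : 0 <= c by apply: le_trans xc; rewrite mulr_ge0 ?(ltW pl)// addr_ge0.
have [c1 c2] := rem_clamp_cont c0 cpi.
have C1 : continuous (cr c) := c1.
have C2 : continuous (sr c) := c2.
split; [by cont|by cont|].
rewrite (truncated_hilbert_kernel Fcont Feven Fsupp) conj_sum_kernel//.
have cs : continuous (fun y => 2 * itg 0 (r_ n) (fun t => sin (2 * pi * (t * (x - y))))).
  apply: contM; first exact: contcst.
  apply: (@cont_param _ _ _ (fun y t => sin (2 * pi * (t * (x - y)))) 1) => [y|t|y t _]; try by cont.
  by rewrite ler_norml sin_geN1 sin_le1.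
rewrite -!itgZ -?itgD -?itgB; try by cont.
apply: eq_itg => y /andP[y1 y2].
have yl : `|x - y| <= `|x| + 2^-1.
  by rewrite (le_trans (ler_normB _ _))// lerD2l ler_norml y1 y2.
have yc : `|pi / l * (x - y)| <= c.
  by rewrite normrM (gtr0_norm pl) (le_trans _ xc)// ler_wpM2l// ltW.
have xl : `|x - y| < l.
  apply: le_lt_trans yl _; rewrite -(ltr_pM2l pl) (le_lt_trans xc)//.
  by rewrite mulrVK// unitfE gt_eqF.
rewrite dirichlet_split// /cr /sr !clamp_id//.
by rewrite -/(r_ n); ring.
Qed.

(** The boundary value of the conjugate series: the Hilbert transform on the
line, corrected by the difference between the kernels of the circle of length
[l] and of the line. *)
Definition hilbertC x : R :=
  hilbertL x + l^-1 * IF (fun y => F y * cot_rem (pi / l * (x - y))).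

(** In [conj_sum_split] the truncated integral converges because the transform of
[F] is integrable, and the oscillating term tends to 0 by Riemann-Lebesgue. *)
Lemma conj_sum_cvg x : `|x| + 2^-1 < l ->
  conj_sum F l n x @[n --> \oo] --> hilbertC x.
Proof.
move=> xl; pose c := pi / l * (`|x| + 2^-1).
have pl : 0 < pi / l by rewrite divr_gt0// pi_gt0.
have cpi : c < pi.
  by rewrite /c -mulrA gtr_pMr ?pi_gt0// mulrC ltr_pdivrMr// mul1r.
have [c1 c2 _] := conj_sum_split 0 cpi (lexx c).
under eq_fun => n do have [_ _ ->] := conj_sum_split n cpi (lexx c).
rewrite -[hilbertC x]subr0; apply: cvgB.
  apply: cvgD; first exact: trunc_cvg.
  rewrite (@eq_itg _ _ _ _ (fun y => F y * cot_rem (pi / l * (x - y)))); first exact: cvg_cst.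
  move=> y /andP[y1 y2]; rewrite /cr clamp_id// normrM (gtr0_norm pl) ler_wpM2l ?(ltW pl)//.
  by rewrite (le_trans (ler_normB _ _))// lerD2l ler_norml y1 y2.
rewrite -(mulr0 l^-1); apply: cvgMr; apply: riemann_lebesgue => // y /Fsupp ->.
by rewrite mul0r.
Qed.

(** For [|x| <= l / 2] and [|y| <= 1 / 2] the argument [pi (x - y) / l] is at most
[c < pi] in absolute value exactly because [1 < l], whence uniformity in [x]. *)
Lemma conj_sum_bound : 1 < l -> exists K, forall n x, `|x| <= l / 2 -> `|conj_sum F l n x| <= K.
Proof.
move=> l1; have [K1 h1] := trunc_bound; have [KF KF0 hF] := F_bounded Fcont Fsupp.
pose c := pi / l * (l / 2 + 2^-1).
have pl : 0 < pi / l by rewrite divr_gt0// pi_gt0.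
have cpi : c < pi.
  by rewrite /c -mulrA gtr_pMr ?pi_gt0// mulrC ltr_pdivrMr// mul1r; lra.
have c0 : 0 <= c by rewrite mulr_ge0 ?(ltW pl)// addr_ge0// divr_ge0// ltW.
have [K2 h2] := rem_bounded cpi.
exists (K1 + l^-1 * (KF * K2) + l^-1 * (KF * K2)) => n x xl.
have [c1 c2 ->] := @conj_sum_split c n x cpi ltac:(by rewrite ler_wpM2l ?(ltW pl)// lerD2r).
have cl v : `|clamp c v| <= c.
  rewrite ler_norml /clamp le_max lexx/= ge_max ge_min lexx/= andbT.
  by rewrite (le_trans _ c0)// oppr_le0.
have B (g : R -> R) : continuous g -> (forall y, `|g y| <= KF * K2) -> `|l^-1 * IF g| <= l^-1 * (KF * K2).
  move=> cg gK; rewrite normrM gtr0_norm ?invr_gt0// ler_pM2l ?invr_gt0//.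
  apply: (@le_trans _ _ (IF (fun=> KF * K2))); first by apply: itg_le_norm => //; exact: contcst.
  have e1 : 2^-1 - - 2^-1 = 1 :> R by lra.
  by rewrite itg_cst ?e1 ?mulr1//; lra.
rewrite (le_trans (ler_normB _ _))// lerD//.
  rewrite (le_trans (ler_normD _ _))// lerD//; first exact: h1.
  apply: B => // y; rewrite normrM ler_pM//.
  exact: (h2 _ (cl _)).1.
apply: B => [|y]; first by cont.
rewrite !normrM -[X in _ <= X]mulr1 ler_pM ?mulr_ge0//; last by rewrite ler_norml cos_geN1 cos_le1.
by rewrite ler_pM//; exact: (h2 _ (cl _)).2.
Qed.
End Period.
End ConjugateLimit.

(** * Comparison of the circle of length l with the line and with the unit circle *)

Section KernelComparison.
Context {R : realType}.
Implicit Types (u v x y t c l : R).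
Local Notation mu := (@lebesgue_measure R).
Local Notation IF g := (itg (- 2^-1) 2^-1 g).

Variable F : R -> R.
Hypothesis Fcont : continuous F.
Hypothesis Feven : forall x, F (- x) = F x.
Hypothesis Fge0 : forall x, 0 <= F x.
Hypothesis Fsupp : forall y, ~~ (- 2^-1 < y < 2^-1) -> F y = 0.
Hypothesis Fint : mu.-integrable setT (EFin \o cosT F).

Lemma symmetrize (k : R -> R) x : continuous k ->
  2 * IF (fun y => F y * k (x - y)) = IF (fun y => F y * (k (x - y) + k (x + y))).
Proof.
move=> ck; under [RHS]eq_itg do rewrite mulrDr.
rewrite itgD; [|by cont|by cont].
have c1 : continuous (fun y => F y * k (x - y)) by cont.
have := @itg_opp R (- 2^-1) 2^-1 _ ltac:(by rewrite ge0_cp ?invr_ge0) c1.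
under eq_itg do rewrite Feven opprK.
by rewrite opprK => ->; rewrite mulr_natl mulr2n.
Qed.

(** After symmetrization in [y] the kernel is [k (x + y) - k (y - x)], and
[y - x <= x + y]. *)
Lemma odd_kernel_le0 (k : R -> R) x : continuous k -> (forall y, k (- y) = - k y) ->
  (forall y z, y <= z -> k z <= k y) -> 0 <= x ->
  IF (fun y => F y * k (x - y)) <= 0.
Proof.
move=> ck ok mk x0; rewrite -(pmulr_rle0 _ (ltr0Sn R 1)) symmetrize//.
rewrite -(itg0 (- 2^-1) 2^-1); apply: le_itg; [by cont|exact: contcst|] => y _.
rewrite mulr_ge0_le0// -(opprK (x - y)) ok opprB addrC subr_le0.
by apply: mk; lra.
Qed.

Lemma clampE c v : 0 <= c ->
  clamp c v = if v < - c then - c else if c < v then c else v.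
Proof.
move=> c0; rewrite /clamp; case: ltP => h1; first by rewrite min_r ?max_l//; lra.
by case: ltP => h2; rewrite ?(min_l (ltW h2)) ?(min_r h2) max_r//; lra.
Qed.

Lemma clampN c v : 0 <= c -> clamp c (- v) = - clamp c v.
Proof. by move=> c0; rewrite !clampE//; repeat case: ltP => ?; lra. Qed.

Lemma le_clamp c v w : 0 <= c -> v <= w -> clamp c v <= clamp c w.
Proof. by move=> c0 vw; rewrite !clampE//; repeat case: ltP => ?; lra. Qed.

Lemma clamp_in c v : 0 <= c -> - c <= clamp c v <= c.
Proof. by move=> c0; rewrite clampE//; repeat case: ltP => ?; lra. Qed.

Lemma dist_supp x y : - 2^-1 <= y <= 2^-1 -> `|x - y| <= `|x| + 2^-1.
Proof.
move=> /andP[y1 y2].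
by rewrite (le_trans (ler_normB _ _))// lerD2l ler_norml y1 y2.
Qed.

(** The difference is the integral of [F] against [cot_rem], odd and
nonincreasing. *)
Lemma hilbertC_le l x : 0 <= x -> x + 2^-1 < l -> hilbertC F l x <= hilbertL F x.
Proof.
move=> x0 xl; have l0 : 0 < l by lra.
pose c := pi / l * (x + 2^-1).
have pl : 0 < pi / l by rewrite divr_gt0// pi_gt0.
have c0 : 0 <= c by rewrite mulr_ge0 ?(ltW pl)// addr_ge0.
have cpi : c < pi.
  by rewrite /c -mulrA gtr_pMr ?pi_gt0// mulrC ltr_pdivrMr// mul1r.
rewrite /hilbertC gerDl pmulr_rle0 ?invr_gt0//.
rewrite (@eq_itg _ _ _ _ (fun y => F y * cot_rem (clamp c (pi / l * (x - y))))); last first.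
  move=> y /(dist_supp x); rewrite (ger0_norm x0) => xy.
  by rewrite clamp_id// normrM (gtr0_norm pl) ler_wpM2l// ltW.
apply: (@odd_kernel_le0 (fun u => cot_rem (clamp c (pi / l * u)))) => //.
- by refine (@contC _ _ (fun u => pi / l * u) (rem_clamp_cont c0 cpi).1 _); cont.
- by move=> y; rewrite mulrN clampN// cot_remN.
- move=> y z yz; apply: cot_rem_nonincreasing.
  + by have /andP[] := clamp_bd (pi / l * y) c0 cpi.
  + by rewrite le_clamp// ler_wpM2l// ltW.
  + by have /andP[] := clamp_bd (pi / l * z) c0 cpi.
Qed.

(** The same comparison, with [cot_diff_nonincreasing]. The restriction to
[x < 1/2] keeps [x - y] in the interval [(-1, 1)] where the kernel of the unit
circle has its only pole at 0. *)
Lemma hilbertC_ge l x : 1 <= l -> 0 <= x -> x < 2^-1 -> hilbertC F 1 x <= hilbertC F l x.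
Proof.
move=> l1 x0 x1; have l0 : 0 < l by lra.
pose c := x + 2^-1; have c0 : 0 <= c by rewrite addr_ge0.
have c1 : c < 1 by rewrite /c; lra.
have clc v : - 1 < clamp c v < 1 by have := clamp_in v c0; lra.
have pp := @pi_gt0 R.
have cc k : 0 < k -> k <= pi -> continuous (fun u => cot_rem (k * clamp c u)).
  move=> k0 kpi u; apply: (@continuous_comp _ _ _ (fun u => k * clamp c u)).
    by apply: contM; [exact: contcst|exact: clamp_cont].
  apply: (rem_cont _).1; rewrite -ltr_norml normrM (gtr0_norm k0).
  have h1 : `|clamp c u| < 1 by rewrite ltr_norml.
  by rewrite (le_lt_trans (ler_wpM2r (normr_ge0 _) kpi))// gtr_pMr.
have pl : 0 < pi / l by rewrite divr_gt0.
have plpi : pi / l <= pi by rewrite ler_piMr ?(ltW pp)// invf_le1.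
have cc1 := cc pi pp (lexx _); have cc2 := cc _ pl plpi.
rewrite /hilbertC lerD2l invr1 mul1r mulr1.
have E k y : - 2^-1 <= y <= 2^-1 -> F y * cot_rem (k * (x - y)) = F y * cot_rem (k * clamp c (x - y)).
  by move=> /(dist_supp x); rewrite (ger0_norm x0) => xy; rewrite clamp_id.
rewrite (eq_itg (E pi)) (eq_itg (E (pi / l))).
have k1 : continuous (fun y => F y * cot_rem (pi * clamp c (x - y))).
  by refine (@contM _ F _ Fcont (@contC _ _ (fun y => x - y) cc1 _)); cont.
have k2 : continuous (fun y => F y * cot_rem (pi / l * clamp c (x - y))).
  by refine (@contM _ F _ Fcont (@contC _ _ (fun y => x - y) cc2 _)); cont.
rewrite -subr_le0 -itgZ// -itgB//; last by cont.
rewrite (@eq_itg _ _ _ _ (fun y => F y * (cot_rem (pi * clamp c (x - y)) -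
   l^-1 * cot_rem (pi / l * clamp c (x - y))))); last by move=> y _; ring.
apply: (@odd_kernel_le0 (fun u => cot_rem (pi * clamp c u) - l^-1 * cot_rem (pi / l * clamp c u))) => //.
- by cont.
- by move=> y; rewrite clampN// !mulrN !cot_remN; ring.
- move=> y z yz; apply: cot_diff_nonincreasing => //.
  + by have /andP[] := clc y.
  + exact: le_clamp.
  + by have /andP[] := clc z.
Qed.

(** For [x > 1/2] the kernel is not singular on the support of [F], so that
[hilbertC F l x] is the integral of [F(y) cot (pi (x - y) / l) / l]. Pairing [y]
with [-y] gives [cot a + cot b = sin (a + b) / (sin a sin b)], where
[a + b = 2 pi x / l <= pi]. *)
Lemma hilbertC_ge0 l x : 1 < l -> 2^-1 < x -> x <= l / 2 -> 0 <= hilbertC F l x.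
Proof.
move=> l1 x1 xl; have l0 : 0 < l by lra.
have pp := @pi_gt0 R; have pl : 0 < pi / l by rewrite divr_gt0.
pose a := pi / l * (x - 2^-1); pose b := pi / l * (x + 2^-1).
have a0 : 0 < a by rewrite mulr_gt0// subr_gt0.
have ab : a <= b by rewrite /a /b ler_wpM2l ?(ltW pl)//; lra.
have bpi : b < pi.
  by rewrite /b -mulrA gtr_pMr// mulrC ltr_pdivrMr// mul1r; lra.
pose cl v := Num.max a (Num.min b v).
have clv v : a <= cl v <= b.
  by rewrite /cl le_max lexx/= ge_max ab ge_min lexx.
have clE v : a <= v <= b -> cl v = v.
  by move=> /andP[av vb]; rewrite /cl min_r// max_r.
have cl_cont : continuous cl by rewrite /cl; cont.
have s0 v : 0 < sin (cl v).
  by have /andP[h1 h2] := clv v; rewrite sin_gt0_pi// (lt_le_trans a0 h1) (le_lt_trans h2).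
pose k1 u := cos (cl (pi / l * u)) / sin (cl (pi / l * u)).
pose k2 u := (sin (cl (pi / l * u)))^-1.
have ck2 : continuous k2.
  by apply: contV => [|u]; [cont|rewrite gt_eqF].
have ck1 : continuous k1 by apply: contM => //; cont.
have rng y : - 2^-1 <= y <= 2^-1 -> a <= pi / l * (x - y) <= b.
  by move=> /andP[y1 y2]; rewrite /a /b !ler_pM2l//; lra.
have E n : conj_sum F l n x = l^-1 * IF (fun y => F y * k1 (x - y)) -
    l^-1 * IF (fun y => F y * k2 (x - y) * cos (pi / l * (2 * n%:R + 1) * (x - y))).
  rewrite conj_sum_kernel// -!itgZ; [|by cont|by cont].
  rewrite -itgB; [|by cont|by cont].
  apply: eq_itg => y /rng yab.
  rewrite /k1 /k2 clE//; have := s0 (pi / l * (x - y)); rewrite clE// => sp.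
  have D := conj_dirichlet n (pi / l * (x - y)).
  have -> : \sum_(i < n) sin (2 * pi * (i.+1%:R / l * (x - y))) =
     \sum_(i < n) sin (2 * i.+1%:R * (pi / l * (x - y))).
    by apply: eq_bigr => i _; congr sin; ring.
  have -> : pi / l * (2 * n%:R + 1) * (x - y) = (2 * n%:R + 1) * (pi / l * (x - y)) by ring.
  move: D sp; move: (cos _) (cos _) (sin (pi / l * (x - y))) (\sum_(i < n) _) => c1 c2 s S D sp.
  have -> : S = (c2 - c1) / (2 * s) by rewrite -D; field; rewrite gt_eqF.
  by field; rewrite !gt_eqF.
(* The limit of the partial sums is computed a second time, without removing the
pole, and identified with [hilbertC] by uniqueness. *)
have L1 : conj_sum F l n x @[n --> \oo] --> l^-1 * IF (fun y => F y * k1 (x - y)).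
  have /funext -> := E.
  rewrite -[X in _ --> X]subr0; apply: cvgB; first exact: cvg_cst.
  rewrite -(mulr0 l^-1); apply: cvgMr; apply: riemann_lebesgue => //; first by cont.
  by move=> y /Fsupp ->; rewrite mul0r.
have L2 : conj_sum F l n x @[n --> \oo] --> hilbertC F l x.
  by apply: conj_sum_cvg => //; rewrite gtr0_norm; lra.
have -> := cvg_unique (@Rhausdorff R) L2 L1.
rewrite pmulr_rge0 ?invr_gt0// -(pmulr_rge0 _ (ltr0Sn R 1)) symmetrize//.
apply: itg_ge0 => y yi; rewrite mulr_ge0// /k1.
have yi' : - 2^-1 <= - y <= 2^-1 by lra.
have := rng _ yi'; rewrite opprK => r2; have r1 := rng _ yi.
have := s0 (pi / l * (x - y)); have := s0 (pi / l * (x + y)).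
rewrite !clE// => sp sq.
have : 0 <= sin (pi / l * (x - y) + pi / l * (x + y)).
  have -> : pi / l * (x - y) + pi / l * (x + y) = pi / l * (x + x) by ring.
  apply: sin_ge0_pi; rewrite mulr_ge0 ?(ltW pl)//=; last by lra.
  by rewrite -mulrA ler_piMr ?(ltW pp)// mulrC ler_pdivrMr// mul1r; lra.
rewrite sinD; move: (cos (pi / l * (x - y))) (cos (pi / l * (x + y))) => c1 c2 sS.
move: (sin (pi / l * (x - y))) (sin (pi / l * (x + y))) sp sq sS => s1 s2 sp sq sS.
have -> : c1 / s1 + c2 / s2 = (s1 * c2 + c1 * s2) / (s1 * s2) by field; rewrite !gt_eqF.
by rewrite divr_ge0// mulr_ge0// ltW.
Qed.

(** The bounds hold almost everywhere because the sup norms are essential ones;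
the points 0 and 1/2, where the comparison with the unit circle gives no lower
bound, belong to the exceptional null set. *)
Lemma conj_sum_ae_bound (M l : R) : 1 < l ->
  {ae mu, forall x, `|hilbertL F x| <= M} ->
  {ae mu, forall x, 0 < x < 2^-1 -> `|hilbertC F 1 x| <= M} ->
  {ae mu, forall x, `[0, l / 2]%classic x ->
     Num.max (`|conj_sum F l n x| - M) 0 @[n --> \oo] --> 0}.
Proof.
move=> l1 h1 h2.
have n0 (r : R) : {ae mu, forall x, x != r}.
  exists [set r]; split => //; first exact: lebesgue_measure_set1.
  by move=> x /= /negP; rewrite negbK => /eqP.
have ff := ae_filter_ringOfSetsType mu.
apply: filterS (filterI h1 (filterI h2 (filterI (n0 0) (n0 2^-1)))) => x /= [hL [hC [x0 x2]]].
rewrite in_itv/= => /andP[xp xl].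
have xp' : 0 < x by rewrite lt_neqAle eq_sym x0.
have L : conj_sum F l n x @[n --> \oo] --> hilbertC F l x.
  by apply: conj_sum_cvg => //; [lra|rewrite gtr0_norm//; lra].
have B : `|hilbertC F l x| <= M.
  move: hL; rewrite !ler_norml => /andP[hL1 hL2]; apply/andP; split; last first.
    by apply: le_trans hL2; apply: hilbertC_le => //; lra.
  have [x3|x3] := ltP x 2^-1.
    have := hC ltac:(by rewrite xp' x3); rewrite ler_norml => /andP[h _].
    by apply: le_trans h _; apply: hilbertC_ge => //; lra.
  have : 0 <= hilbertC F l x by apply: hilbertC_ge0 => //; rewrite lt_neqAle eq_sym x2.
  by lra.
have LM : `|conj_sum F l n x| - M @[n --> \oo] --> `|hilbertC F l x| - M.
  by apply: cvgB; [exact: cvg_norm|exact: cvg_cst].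
have cmax : continuous (fun z : R => Num.max z 0) by cont.
have := @continuous_cvg _ _ _ _ _ _ (fun z : R => Num.max z 0) _ (cmax _) LM.
by rewrite /= max_r ?subr_le0//; apply.
Qed.
End KernelComparison.

(** * The logarithm of a linear factor and its conjugate *)

Section LogKernel.
Context {R : realType}.
Implicit Types (u v x y t c l r : R).

(** [log |1 - r e(u)|] and [- arg (1 - r e(u))], with Fourier series the limits of
[- cos_sum] and [sin_sum]. *)
Definition logk r u : R := ln (1 - 2 * r * cos (2 * pi * u) + r ^+ 2) / 2.
Definition argk r u : R :=
  atan (r * sin (2 * pi * u) / (1 - r * cos (2 * pi * u))).

Definition cos_sum r n u : R :=
  \sum_(i < n) r ^+ i.+1 / i.+1%:R * cos (2 * pi * (i.+1%:R * u)).
Definition sin_sum r n u : R :=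
  \sum_(i < n) r ^+ i.+1 / i.+1%:R * sin (2 * pi * (i.+1%:R * u)).

(** The [r]-derivative of the Fourier partial sum, up to two boundary terms that
tend to 0 with [r ^+ n], is that of [- logk]. *)
Lemma cos_sum_den r n v :
  (1 - 2 * r * cos v + r ^+ 2) * \sum_(i < n) r ^+ i * cos (i.+1%:R * v) =
  cos v - r - r ^+ n * cos (n.+1%:R * v) + r ^+ n.+1 * cos (n%:R * v).
Proof.
elim: n => [|n IH]; first by rewrite big_ord0 mul0r cos0 !mul1r; ring.
rewrite big_ord_recr/= mulrDr IH.
have -> : n.+2%:R * v = n.+1%:R * v + v by ring.
have -> : n%:R * v = n.+1%:R * v - v by rewrite -natr1; ring.
by rewrite !cosD cosN sinN !exprS; ring.
Qed.

Lemma sin_sum_den r n v :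
  (1 - 2 * r * cos v + r ^+ 2) * \sum_(i < n) r ^+ i * sin (i.+1%:R * v) =
  sin v - r ^+ n * sin (n.+1%:R * v) + r ^+ n.+1 * sin (n%:R * v).
Proof.
elim: n => [|n IH]; first by rewrite big_ord0 mul0r sin0 !mul1r; ring.
rewrite big_ord_recr/= mulrDr IH.
have -> : n.+2%:R * v = n.+1%:R * v + v by ring.
have -> : n%:R * v = n.+1%:R * v - v by rewrite -natr1; ring.
by rewrite !sinD cosN sinN !exprS; ring.
Qed.

Lemma den_ge r v : 0 <= r -> (1 - r) ^+ 2 <= 1 - 2 * r * cos v + r ^+ 2.
Proof. by move=> r0; have := cos_le1 v; nra. Qed.

Lemma den_gt0 r v : 0 <= r < 1 -> 0 < 1 - 2 * r * cos v + r ^+ 2.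
Proof.
move=> /andP[r0 r1]; apply: lt_le_trans (den_ge v r0).
by rewrite exprn_gt0// subr_gt0.
Qed.

Lemma rcos_gt0 r v : 0 <= r < 1 -> 0 < 1 - r * cos v.
Proof. by move=> /andP[r0 r1]; have := cos_le1 v; nra. Qed.

Lemma mvt_bound (f d : R -> R) r K : 0 <= r ->
  (forall x, 0 <= x <= r -> is_derive x 1 f (d x)) ->
  (forall x, 0 <= x <= r -> `|d x| <= K) -> `|f r - f 0| <= K * r.
Proof.
move=> r0 df dK.
have [x xi||c] := @MVT_segment R f d 0 r r0.
- by apply: df; move: xi; rewrite in_itv/= => /andP[/ltW -> /ltW ->].
- apply: continuous_in_subspaceT => x; rewrite inE/= in_itv/= => xi.
  apply: differentiable_continuous; apply/derivable1_diffP.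
  by have [] := df x xi.
rewrite in_itv/= => ci; rewrite subr0 => ->.
by rewrite normrM (ger0_norm r0) ler_wpM2r// dK.
Qed.

Lemma quot_bound r n x a b d : 0 <= x <= r -> r < 1 -> `|a| <= 1 -> `|b| <= 1 ->
  (1 - x) ^+ 2 <= d ->
  `|(- (x ^+ n * a) + x ^+ n.+1 * b) / d| <= 2 * r ^+ n / (1 - r) ^+ 2.
Proof.
move=> /andP[x0 xr] r1 a1 b1 xd.
have r0 : 0 <= r by apply: le_trans xr.
have e1 : 0 < (1 - r) ^+ 2 by rewrite exprn_gt0// subr_gt0.
have e2 : (1 - r) ^+ 2 <= (1 - x) ^+ 2 by rewrite lerXn2r ?nnegrE; lra.
have d0 : 0 < d by apply: lt_le_trans xd; apply: lt_le_trans e2.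
rewrite normrM normfV (gtr0_norm d0) ler_pM ?invr_ge0 ?(ltW d0)//; last first.
  by rewrite lef_pV2 ?posrE// (le_trans e2).
have xn : x ^+ n <= r ^+ n by rewrite lerXn2r ?nnegrE.
have xn0 : 0 <= x ^+ n by rewrite exprn_ge0.
rewrite (le_trans (ler_normD _ _))// normrN !normrM exprS normrM.
rewrite (ger0_norm xn0) (ger0_norm x0) mulr2n mulrDl mul1r lerD//.
  by rewrite (le_trans _ xn)// ler_piMr.
have x1 : x <= 1 by rewrite (le_trans xr)// ltW.
by apply: le_trans xn; rewrite -[leRHS]mulr1 ler_pM ?mulr_ge0// ler_piMl.
Qed.

Lemma is_derive_Ml (f : R -> R) k x d : is_derive x 1 f d ->
  is_derive x 1 (fun y => k * f y) (k * d).
Proof. by move=> D; exact: (@is_deriveZ _ _ _ f k x 1 d). Qed.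

Lemma is_derive_Mr (f : R -> R) k x d : is_derive x 1 f d ->
  is_derive x 1 (fun y => f y * k) (d * k).
Proof.
by move=> /is_derive_Ml D; rewrite mulrC; under eq_fun do rewrite mulrC; exact: D.
Qed.

Lemma is_derive_pow n x : is_derive x 1 (fun y : R => y ^+ n) (n%:R * x ^+ n.-1).
Proof.
have D := is_deriveX n (is_derive_id x (1 : R)).
rewrite /GRing.scale/= mulr1 in D.
rewrite (_ : (fun y => _) = (id : R -> R) ^+ n)//.
by apply/funext => y; rewrite exprfctE.
Qed.

Lemma is_derive_powers (a : nat -> R) n x :
  is_derive x 1 (fun y : R => \sum_(i < n) y ^+ i.+1 / i.+1%:R * a i)
    (\sum_(i < n) x ^+ i * a i).
Proof.
elim: n => [|n IH].
  rewrite big_ord0; under eq_fun do rewrite big_ord0.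
  exact: is_derive_cst.
rewrite big_ord_recr/=; under eq_fun do rewrite big_ord_recr/=.
have D := is_derive_Mr (a n) (is_derive_Mr n.+1%:R^-1 (is_derive_pow n.+1 x)).
have E : n.+1%:R * x ^+ n.+1.-1 / n.+1%:R * a n = x ^+ n * a n.
  by congr (_ * _); rewrite mulrAC divff ?mul1r// pnatr_eq0.
by have := is_deriveD IH D; rewrite E.
Qed.

Definition approx_err r n : R := 2 * r ^+ n / (1 - r) ^+ 2 * r.

(** As a function of [r] the left-hand side vanishes at 0, and by [cos_sum_den]
its derivative is the quotient of the two boundary terms by [|1 - r e(u)|^2]; the
mean value theorem then bounds it uniformly in [u]. *)
Lemma logk_approx r n u : 0 <= r < 1 -> `|logk r u + cos_sum r n u| <= approx_err r n.
Proof.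
move=> /andP[r0 r1]; pose v := 2 * pi * u.
pose f x := ln (1 - 2 * x * cos v + x ^+ 2) / 2 +
   \sum_(i < n) x ^+ i.+1 / i.+1%:R * cos (i.+1%:R * v).
have fr : f r = logk r u + cos_sum r n u.
  by rewrite /f /logk -/v; congr (_ + _); apply: eq_bigr => i _; congr (_ * cos _); rewrite /v; ring.
have f0 : f 0 = 0.
  rewrite /f mulr0 mul0r subr0 expr0n/= addr0 ln1 mul0r add0r big1// => i _.
  by rewrite exprS !mul0r.
have := @mvt_bound f (fun x => (- (x ^+ n * cos (n.+1%:R * v)) + x ^+ n.+1 * cos (n%:R * v)) /
   (1 - 2 * x * cos v + x ^+ 2)) r (2 * r ^+ n / (1 - r) ^+ 2) r0.
rewrite fr f0 subr0; apply => x /andP[x0 xr].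
  have d0 : 0 < 1 - 2 * x * cos v + x ^+ 2 by apply: den_gt0; rewrite x0 (le_lt_trans xr).
  have D1 := is_derive_powers (fun i => cos (i.+1%:R * v)) n x.
  have D2 := is_derive1_ln d0.
  have D3 : is_derive x 1 (fun x => 1 - 2 * x * cos v + x ^+ 2) (2 * x - 2 * cos v).
    refine (is_derive_eq (is_deriveD (is_deriveB (is_derive_cst (1 : R) x 1)
      (is_derive_Mr (cos v) (is_derive_Ml 2 (is_derive_id x (1 : R))))) (is_derive_pow 2 x)) _).
    by rewrite sub0r mulr1 expr1 addrC.
  have D4 := is_derive_Mr 2^-1 (@is_derive1_comp _ _ (fun x => 1 - 2 * x * cos v + x ^+ 2) x _ _ D2 D3).
  have D5 := is_deriveD D4 D1.
  apply: (is_derive_eq D5).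
  have -> : \sum_(i < n) x ^+ i * cos (i.+1%:R * v) =
      (cos v - x - x ^+ n * cos (n.+1%:R * v) + x ^+ n.+1 * cos (n%:R * v)) /
      (1 - 2 * x * cos v + x ^+ 2).
    by rewrite -cos_sum_den mulrAC divff ?mul1r// gt_eqF.
  move: d0; move: (1 - 2 * x * cos v + x ^+ 2) (x ^+ n * _) (x ^+ n.+1 * _) (cos v) => d a b c d0.
  by field; rewrite gt_eqF.
apply: quot_bound => //; rewrite ?x0 ?xr//; try by rewrite ler_norml cos_geN1 cos_le1.
exact: den_ge.
Qed.

Lemma argk_approx r n u : 0 <= r < 1 -> `|argk r u - sin_sum r n u| <= approx_err r n.
Proof.
move=> /andP[r0 r1]; pose v := 2 * pi * u.
pose f x := - \sum_(i < n) x ^+ i.+1 / i.+1%:R * sin (i.+1%:R * v) +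
   atan (x * sin v / (1 - x * cos v)).
have fr : - f r = - (argk r u - sin_sum r n u).
  rewrite /f /argk -/v addrC; congr (- (_ - _)); apply: eq_bigr => i _.
  by congr (_ * sin _); rewrite /v; ring.
have f0 : f 0 = 0.
  rewrite /f !mul0r atan0 addr0 big1 ?oppr0// => i _.
  by rewrite exprS !mul0r.
have := @mvt_bound f (fun x => - ((- (x ^+ n * sin (n.+1%:R * v)) + x ^+ n.+1 * sin (n%:R * v)) /
   (1 - 2 * x * cos v + x ^+ 2))) r (2 * r ^+ n / (1 - r) ^+ 2) r0.
rewrite f0 subr0 -normrN fr normrN; apply => x /andP[x0 xr]; last first.
  rewrite normrN; apply: quot_bound => //; rewrite ?x0 ?xr//; try by rewrite ler_norml sin_geN1 sin_le1.
  exact: den_ge.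
have xi : 0 <= x < 1 by rewrite x0 (le_lt_trans xr).
have d0 := den_gt0 v xi; have q0 := rcos_gt0 v xi.
have D1 := is_deriveN (is_derive_powers (fun i => sin (i.+1%:R * v)) n x).
have D3 : is_derive x 1 (fun x => 1 - x * cos v) (- cos v).
  refine (is_derive_eq (is_deriveB (is_derive_cst (1 : R) x 1)
    (is_derive_Mr (cos v) (is_derive_id x (1 : R)))) _).
  by rewrite sub0r mul1r.
have D4 := is_deriveM (is_derive_Mr (sin v) (is_derive_id x (1 : R)))
   (@is_deriveV _ (fun x => 1 - x * cos v) x _ _ ltac:(by rewrite gt_eqF) D3).
have D6 := @is_derive1_comp _ _ (fun x => x * sin v / (1 - x * cos v)) x _ _ (is_derive1_atan _) D4.
refine (is_derive_eq (is_deriveD D1 D6) _).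
have -> : \sum_(i < n) x ^+ i * sin (i.+1%:R * v) =
    (sin v - x ^+ n * sin (n.+1%:R * v) + x ^+ n.+1 * sin (n%:R * v)) /
    (1 - 2 * x * cos v + x ^+ 2).
  by rewrite -sin_sum_den mulrAC divff ?mul1r// gt_eqF.
rewrite /GRing.scale/=.
have cs : 1 - 2 * x * cos v + x ^+ 2 = (1 - x * cos v) ^+ 2 + (x * sin v) ^+ 2.
  have -> : (1 - x * cos v) ^+ 2 + (x * sin v) ^+ 2 =
     1 - 2 * x * cos v + x ^+ 2 * (cos v ^+ 2 + sin v ^+ 2) by ring.
  by rewrite cos2Dsin2 mulr1.
move: d0; rewrite cs; move: (x ^+ n * _) (x ^+ n.+1 * _) => a b d0.
have -> : (1 + (x * sin v / (1 - x * cos v)) ^+ 2)^-1 =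
   (1 - x * cos v) ^+ 2 / ((1 - x * cos v) ^+ 2 + (x * sin v) ^+ 2).
  rewrite -[RHS]invrK invf_div; congr (_^-1).
  by field; rewrite gt_eqF.
by field; rewrite !gt_eqF.
Qed.

Lemma approx_err_cvg r : 0 <= r < 1 -> approx_err r n @[n --> \oo] --> 0.
Proof.
move=> /andP[r0 r1].
have h : r ^+ n @[n --> \oo] --> 0 by apply: cvg_expr; rewrite ger0_norm.
rewrite /approx_err.
have -> : (fun n => 2 * r ^+ n / (1 - r) ^+ 2 * r) = (fun n => 2 * r / (1 - r) ^+ 2 * r ^+ n).
  by apply/funext => n; ring.
by rewrite -[X in _ --> X](mulr0 (2 * r / (1 - r) ^+ 2)); exact: cvgMr.
Qed.
End LogKernel.

(** * Pairing log |Q| with the conjugate series *)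

Section LogConvolution.
Context {R : realType}.
Implicit Types (u v x y t b c l r : R) (bs : seq R).
Local Notation mu := (@lebesgue_measure R).
Local Notation IF g := (itg (- 2^-1) 2^-1 g).

Lemma cos_sin_addn x n :
  cos (x + 2 * pi * n%:R) = cos x /\ sin (x + 2 * pi * n%:R) = sin x.
Proof.
elim: n => [|n [IH1 IH2]]; first by rewrite mulr0 addr0.
have -> : x + 2 * pi * n.+1%:R = x + 2 * pi * n%:R + pi *+ 2.
  by rewrite -natr1 mulr2n; ring.
by rewrite cosD (sinD (x + _)) cos2pi sin2pi IH1 IH2 !mulr0 !mulr1 subr0 addr0.
Qed.

Section Orthogonality.
Variable l : R.
Hypothesis l0 : 0 < l.

Let ll : - (l / 2) <= l / 2. Proof. by have := l0; lra. Qed.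

Lemma itg_sin_harm p q : (0 < p)%N ->
  itg (- (l / 2)) (l / 2) (fun x => sin (2 * pi * (p%:R / l) * x + q)) = 0.
Proof.
move=> p0; pose k := 2 * pi * (p%:R / l).
have k0 : k != 0 by rewrite gt_eqF// !mulr_gt0 ?pi_gt0 ?invr_gt0 ?ltr0n.
have dG x : is_derive x 1 (fun x => - k^-1 * cos (k * x + q)) (sin (k * x + q)).
  have D := is_derive_Ml (- k^-1) (is_derive_aff (is_derive_cos (k * x + q))).
  by apply: (is_derive_eq D); rewrite mulNr !mulrN opprK mulKf.
rewrite (@itg_primitive R _ _ _ (fun x => - k^-1 * cos (k * x + q)))//; last by cont.
have -> : k * (l / 2) + q = k * - (l / 2) + q + 2 * pi * p%:R.
  by rewrite /k; field; rewrite gt_eqF.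
by rewrite (cos_sin_addn _ p).1 subrr.
Qed.

Lemma itg_cos_harm j b : (0 < j)%N ->
  itg (- (l / 2)) (l / 2) (fun x => cos (2 * pi * (j%:R * (x / l - b)))) = 0.
Proof.
move=> j0; rewrite -(itg_sin_harm (- 2 * pi * (j%:R * b) + pi / 2) j0).
apply: eq_itg => x _.
have -> : 2 * pi * (j%:R / l) * x + (- 2 * pi * (j%:R * b) + pi / 2) =
   2 * pi * (j%:R * (x / l - b)) + pi / 2 by ring.
by rewrite sinD sin_pihalf cos_pihalf mulr0 mulr1 add0r.
Qed.

Lemma itg_cos_sin j k b : (0 < j)%N -> (0 < k)%N ->
  itg (- (l / 2)) (l / 2) (fun x => cos (2 * pi * (j%:R * (x / l - b))) * sin (2 * pi * (k%:R / l * x)))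
  = if j == k then l / 2 * sin (2 * pi * (k%:R * b)) else 0.
Proof.
move=> j0 k0.
pose A x := 2 * pi * (j%:R * (x / l - b)); pose B x := 2 * pi * (k%:R / l * x).
pose f1 x := sin (2 * pi * ((k + j)%N%:R / l) * x + - (2 * pi * (j%:R * b))).
have c1 : continuous f1 by rewrite /f1; cont.
have cA : continuous A by rewrite /A; cont.
have cB : continuous B by rewrite /B; cont.
have -> : itg (- (l / 2)) (l / 2) (fun x => cos (A x) * sin (B x)) =
   2^-1 * itg (- (l / 2)) (l / 2) (fun x => sin (B x - A x)).
  transitivity (2^-1 * itg (- (l / 2)) (l / 2) (fun x => f1 x + sin (B x - A x))).
    rewrite -itgZ; last by cont.
    apply: eq_itg => x _.
    have -> : f1 x = sin (B x + A x) by rewrite /f1 /A /B natrD; congr sin; ring.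
    by rewrite !sinD sinN cosN; field.
  by rewrite itgD//; [rewrite itg_sin_harm ?add0r// addn_gt0 k0|cont].
case: ltngtP => jk.
- rewrite (@eq_itg _ _ _ _ (fun x => sin (2 * pi * ((k - j)%N%:R / l) * x + 2 * pi * (j%:R * b)))).
    by rewrite itg_sin_harm ?mulr0// subn_gt0.
  by move=> x _; rewrite /A /B natrB ?(ltnW jk)//; congr sin; ring.
- rewrite (@eq_itg _ _ _ _ (fun x => - sin (2 * pi * ((j - k)%N%:R / l) * x + - (2 * pi * (j%:R * b))))).
    rewrite itgN; last by cont.
    by rewrite itg_sin_harm ?oppr0 ?mulr0// subn_gt0.
  by move=> x _; rewrite /A /B natrB ?(ltnW jk)// -sinN; congr sin; ring.
- rewrite (@eq_itg _ _ _ _ (fun=> sin (2 * pi * (k%:R * b)))).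
    by rewrite itg_cst//; field.
  by move=> x _; rewrite /A /B jk; congr sin; ring.
Qed.

End Orthogonality.

Lemma logk_cont r : 0 <= r < 1 -> continuous (logk r).
Proof.
move=> r01; apply: contM; last exact: contcst.
by apply: contln => [|x]; [cont|exact: den_gt0].
Qed.

Lemma argk_cont r : 0 <= r < 1 -> continuous (argk r).
Proof.
move=> r01; apply: contatan; apply: contM; first by cont.
by apply: contV => [|x]; [cont|rewrite gt_eqF// rcos_gt0].
Qed.

Lemma cos_sum_cont r n : continuous (cos_sum r n).
Proof. by rewrite /cos_sum; cont. Qed.

Lemma sin_sum_cont r n : continuous (sin_sum r n).
Proof. by rewrite /sin_sum; cont. Qed.

Lemma le_cvg (u : nat -> R) L X : u n @[n --> \oo] --> L -> (forall n, X <= u n) -> X <= L.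
Proof.
move=> uL Xu; apply: (cvgr_to_ge uL); exact: nearW.
Qed.

Lemma approx_err_ge0 r n : 0 <= r < 1 -> 0 <= approx_err r n.
Proof.
move=> /andP[r0 r1].
by rewrite /approx_err !mulr_ge0 ?exprn_ge0 ?invr_ge0 ?exprn_ge0// subr_ge0 ltW.
Qed.

(** [log |1 - r e(u)|] has mean 0. *)
Lemma itg_logk l r b : 0 < l -> 0 <= r < 1 ->
  itg (- (l / 2)) (l / 2) (fun x => logk r (x / l - b)) = 0.
Proof.
move=> l0 r01; apply/eqP; rewrite -normr_le0.
have ll : - (l / 2) <= l / 2 by lra.
have cl := logk_cont r01.
have E : approx_err r n * l @[n --> \oo] --> 0.
  by rewrite -(mul0r l); apply: cvgMl; exact: approx_err_cvg.
apply: (le_cvg E) => n.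
have cs := @cos_sum_cont r n.
have Z : itg (- (l / 2)) (l / 2) (fun x => cos_sum r n (x / l - b)) = 0.
  rewrite /cos_sum itg_sum; last by move=> i; cont.
  by rewrite big1// => i _; rewrite itgZ ?itg_cos_harm ?mulr0//; cont.
rewrite -[X in `|X|]addr0 -[in X in _ + X]Z -itgD; [|by cont|by cont].
have -> : approx_err r n * l = itg (- (l / 2)) (l / 2) (fun=> approx_err r n).
  by rewrite itg_cst//; field.
apply: itg_le_norm; [by cont|exact: contcst|] => x _.
exact: logk_approx.
Qed.

Variable F : R -> R.
Hypothesis Fcont : continuous F.
Hypothesis Feven : forall x, F (- x) = F x.
Hypothesis Fsupp : forall y, ~~ (- 2^-1 < y < 2^-1) -> F y = 0.

(** Parseval for trigonometric polynomials: by orthogonality only the terms of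
equal frequency survive, and [cosT_sin] puts the coefficients of [F] back under
an integral. *)
Lemma itg_cos_sum_conj l r n b : 0 < l ->
  itg (- (l / 2)) (l / 2) (fun x => cos_sum r n (x / l - b) * conj_sum F l n x) =
  IF (fun t => F t * sin_sum r n (b - t / l)).
Proof.
move=> l0.
have cs i : continuous (fun x : R => sin (2 * pi * (i.+1%:R / l * x))) by cont.
have cc i : continuous (fun x : R => cos (2 * pi * (i.+1%:R * (x / l - b)))) by cont.
pose w (i : nat) := r ^+ i.+1 / i.+1%:R; pose z (i : nat) := 2 / l * cosT F (i.+1%:R / l).
transitivity (\sum_(i < n) \sum_(k < n) w i * z k *
   itg (- (l / 2)) (l / 2) (fun x => cos (2 * pi * (i.+1%:R * (x / l - b))) * sin (2 * pi * (k.+1%:R / l * x)))).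
  rewrite (@eq_itg _ _ _ _ (fun x => \sum_(i < n) \sum_(k < n) w i * z k *
    (cos (2 * pi * (i.+1%:R * (x / l - b))) * sin (2 * pi * (k.+1%:R / l * x))))).
    rewrite itg_sum; last first.
      by move=> i; apply: cont_sum => k; apply: contM; [exact: contcst|exact: contM].
    apply: eq_bigr => i _; rewrite itg_sum.
      by apply: eq_bigr => k _; rewrite itgZ//; exact: contM.
    by move=> k; apply: contM; [exact: contcst|exact: contM].
  move=> x _; rewrite /cos_sum /conj_sum mulr_suml; apply: eq_bigr => i _.
  by rewrite !mulr_sumr; apply: eq_bigr => k _; rewrite /w /z; ring.
rewrite /sin_sum.
under [RHS]eq_itg do rewrite mulr_sumr.
rewrite itg_sum; last by move=> i; cont.
apply: eq_bigr => i _.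
under eq_bigr do rewrite itg_cos_sin//.
rewrite (bigD1 i)//= eqxx big1 ?addr0; last first.
  move=> k ki; rewrite eqSS; case: eqP => [e|_]; last by rewrite mulr0.
  by case/negP: ki; apply/eqP/val_inj.
have -> : w i * z i * (l / 2 * sin (2 * pi * (i.+1%:R * b))) =
   w i * (cosT F (i.+1%:R / l) * sin (2 * pi * (i.+1%:R / l * (l * b)))).
  rewrite (_ : i.+1%:R / l * (l * b) = i.+1%:R * b); last by field; rewrite gt_eqF.
  by rewrite /z; field; rewrite gt_eqF.
rewrite cosT_sin// -itgZ; last by cont.
apply: eq_itg => t _; rewrite -/(w i) mulrCA; congr (_ * (_ * sin _)).
by field; rewrite gt_eqF.
Qed.
End LogConvolution.

Section PairingBound.
Context {R : realType}.
Implicit Types (u v x y t b c l r : R) (bs : seq R).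
Local Notation mu := (@lebesgue_measure R).
Local Notation IF g := (itg (- 2^-1) 2^-1 g).

Variable F : R -> R.
Hypothesis Fcont : continuous F.
Hypothesis Feven : forall x, F (- x) = F x.
Hypothesis Fge0 : forall x, 0 <= F x.
Hypothesis Fsupp : forall y, ~~ (- 2^-1 < y < 2^-1) -> F y = 0.
Hypothesis Fint : mu.-integrable setT (EFin \o cosT F).

Variable M : R.
Hypothesis hL : {ae mu, forall x, `|hilbertL F x| <= M}.
Hypothesis hC : {ae mu, forall x, 0 < x < 2^-1 -> `|hilbertC F 1 x| <= M}.

Lemma conj_sum_odd l n x : conj_sum F l n (- x) = - conj_sum F l n x.
Proof.
rewrite /conj_sum -mulrN; congr (_ * _); rewrite -sumrN; apply: eq_bigr => i _.
by rewrite !mulrN sinN mulrN.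
Qed.

(** The partial sums exceed [M] only by a bounded quantity that tends to 0 almost
everywhere, so that by dominated convergence the excess contributes an error
tending to 0. *)
Lemma conj_pairing l (g : R -> R) : 1 < l -> continuous g ->
  exists2 e : nat -> R, e n @[n --> \oo] --> 0 &
  forall n, `|itg (- (l / 2)) (l / 2) (fun x => g x * conj_sum F l n x)| <=
    M * itg (- (l / 2)) (l / 2) (fun x => `|g x|) + e n.
Proof.
move=> l1 cg; have l0 : 0 < l by lra.
have l2 : 0 <= l / 2 by lra.
have l2' : - (l / 2) <= 0 by lra.
have cs n : continuous (conj_sum F l n) := @conj_sum_cont R F l n.
(* The partial sums are odd and controlled for nonnegative arguments only, so the
period is folded onto [[0, l / 2]]. *)
have fold (f : R -> R) : continuous f ->
    itg (- (l / 2)) (l / 2) f = itg 0 (l / 2) (fun x => f x + f (- x)).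
  move=> cf; rewrite itgD//; last by cont.
  by rewrite (itg_chasles l2' l2 cf) itg_opp// oppr0 addrC.
pose G x := `|g x| + `|g (- x)|.
have cG : continuous G by rewrite /G; cont.
pose d n x := Num.max (`|conj_sum F l n x| - M) 0.
have cd n : continuous (d n) by have c1 := cs n; rewrite /d; cont.
exists (fun n => itg 0 (l / 2) (fun x => G x * d n x)).
  have [KG hG] := @bounded_itv R 0 (l / 2) G cG.
  have [K hK] := conj_sum_bound Fcont Feven Fsupp Fint l0 l1.
  have ae := conj_sum_ae_bound Fcont Feven Fge0 Fsupp Fint l1 hL hC.
  have := @itg_dct R 0 (l / 2) (fun n x => G x * d n x) (fun=> 0) (KG * (K + `|M|)).
  rewrite itg0 => h; apply: (h _ _ _ _).2 => //.
  - by move=> n; have c1 := cd n; cont.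
  - move=> n x /andP[x0 xl]; rewrite normrM ler_pM//; first by rewrite hG ?x0.
    have k1 := hK n x ltac:(by rewrite ger0_norm).
    have k2 := ler_norm (- M); rewrite normrN in k2.
    have k3 := normr_ge0 M; have k4 := normr_ge0 (conj_sum F l n x).
    rewrite /d ger0_norm; last by rewrite le_max lexx orbT.
    by rewrite ge_max; apply/andP; split; lra.
  - apply: (@filterS _ _ (ae_filter_ringOfSetsType mu)) ae => x h1 /h1 h2.
    by rewrite -(mulr0 (G x)); apply: cvgMr.
move=> n; have c1 := cs n; have c2 := cd n.
rewrite (fold (fun x => g x * conj_sum F l n x)); last by cont.
rewrite (fold (fun x => `|g x|)); last by cont.
rewrite -itgZ; last by cont.
rewrite -itgD; [|by cont|by cont].
apply: itg_le_norm; [by cont|by cont|] => x _.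
rewrite conj_sum_odd mulrN -mulrBl normrM -/(G x) [M * _]mulrC -mulrDr.
rewrite ler_pM ?normr_ge0//; first exact: ler_normB.
by rewrite -lerBlDl le_max lexx.
Qed.

(** Truncating both series at order [n] reduces the claim to [itg_cos_sum_conj]
and [conj_pairing]; each truncation costs a multiple of [approx_err r n], and the
left-hand side and the main term on the right do not depend on [n]. *)
Lemma argk_bound l r bs : 1 < l -> 0 <= r < 1 ->
  `|IF (fun t => F t * \sum_(b <- bs) argk r (b - t / l))| <=
    M * itg (- (l / 2)) (l / 2) (fun x => `|\sum_(b <- bs) logk r (x / l - b)|).
Proof.
move=> l1 r01; have l0 : 0 < l by lra.
have ll : - (l / 2) <= l / 2 by lra.
have cl := logk_cont r01; have ca := argk_cont r01.
have css n := @sin_sum_cont R r n; have ccs n := @cos_sum_cont R r n.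
pose g x := \sum_(b <- bs) logk r (x / l - b).
have cg : continuous g by rewrite /g; cont.
have [e ec eP] := conj_pairing l1 cg.
have [K hK] := conj_sum_bound Fcont Feven Fsupp Fint l0 l1.
have [KF KF0 hF] := F_bounded Fcont Fsupp.
pose S := (size bs)%:R : R.
have sumle (f : R -> R) k : (forall b, `|f b| <= k) -> `|\sum_(b <- bs) f b| <= S * k.
  move=> fk; rewrite (le_trans (ler_norm_sum _ _ _))//.
  rewrite (le_trans (ler_sum _ (fun b _ => fk b)))//.
  by rewrite big_const_seq count_predT iter_addr_0 mulr_natl.
pose E n := M * itg (- (l / 2)) (l / 2) (fun x => `|g x|) + e n +
   S * approx_err r n * K * l + KF * (S * approx_err r n).
have Ec : E n @[n --> \oo] --> M * itg (- (l / 2)) (l / 2) (fun x => `|g x|).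
  have a0 := approx_err_cvg r01.
  rewrite -[X in _ --> X]addr0 -[X in _ --> X + _]addr0 -[X in _ --> X + _ + _]addr0.
  apply: cvgD; last by rewrite -(mulr0 KF); apply: cvgMr; rewrite -(mulr0 S); apply: cvgMr.
  apply: cvgD; last first.
    rewrite -(mul0r l); apply: cvgMl; rewrite -(mul0r K); apply: cvgMl.
    by rewrite -(mulr0 S); apply: cvgMr.
  by apply: cvgD => //; exact: cvg_cst.
apply: (le_cvg Ec) => n.
have c0 := css n; have c1 := ccs n; have c2 := @conj_sum_cont R F l n.
have e0 := approx_err_ge0 n r01.
have A1 : `|IF (fun t => F t * \sum_(b <- bs) argk r (b - t / l)) -
            IF (fun t => F t * \sum_(b <- bs) sin_sum r n (b - t / l))| <= KF * (S * approx_err r n).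
  rewrite -itgB; [|by cont|by cont].
  rewrite (_ : KF * _ = IF (fun=> KF * (S * approx_err r n))).
    apply: itg_le_norm; [by cont|exact: contcst|] => t _.
    rewrite -mulrBr -sumrB normrM ler_pM// (sumle (fun b => argk r (b - t / l) - sin_sum r n (b - t / l)))// => b.
    exact: argk_approx.
  have h1 : 2^-1 - - 2^-1 = 1 :> R by lra.
  by rewrite itg_cst ?h1 ?mulr1//; lra.
have A2 : IF (fun t => F t * \sum_(b <- bs) sin_sum r n (b - t / l)) =
    itg (- (l / 2)) (l / 2) (fun x => (\sum_(b <- bs) cos_sum r n (x / l - b)) * conj_sum F l n x).
  under eq_itg do rewrite mulr_sumr.
  rewrite itg_sum; last by move=> b; cont.
  under [RHS]eq_itg do rewrite mulr_suml.
  rewrite itg_sum; last by move=> b; cont.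
  by apply: eq_bigr => b _; rewrite itg_cos_sum_conj.
have A3 : `|itg (- (l / 2)) (l / 2) (fun x => g x * conj_sum F l n x) +
   itg (- (l / 2)) (l / 2) (fun x => (\sum_(b <- bs) cos_sum r n (x / l - b)) * conj_sum F l n x)|
   <= S * approx_err r n * K * l.
  rewrite -itgD; [|by cont|by cont].
  rewrite (_ : _ * l = itg (- (l / 2)) (l / 2) (fun=> S * approx_err r n * K)).
    apply: itg_le_norm; [by cont|exact: contcst|] => x xi.
    rewrite -mulrDl -big_split/= normrM ler_pM//; last first.
      by apply: hK; rewrite ler_norml.
    apply: (sumle (fun b => logk r (x / l - b) + cos_sum r n (x / l - b))) => b.
    exact: logk_approx.
  by rewrite itg_cst//; field.
have A4 := eP n.
rewrite A2 in A1; rewrite /E.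
move: A1 A3 A4; move: (itg _ _ _) (itg _ _ _) (itg _ _ _) => X Y Z.
rewrite !ler_norml => /andP[a1 a2] /andP[b1 b2] /andP[d1 d2].
by apply/andP; split; lra.
Qed.

End PairingBound.

(** * The boundary values at radius 1 *)

Section RadialLimit.
Context {R : realType}.
Implicit Types (u v x y t b c l r : R) (bs : seq R).
Local Notation mu := (@lebesgue_measure R).
Local Notation IF g := (itg (- 2^-1) 2^-1 g).

(** The centred staircase: at an integer it takes the middle of the jump. *)
Definition stair u : R := ((Num.floor u)%:~R + (Num.ceil u)%:~R) / 2.

Definition radius (n : nat) : R := 1 - harmonic n.

Lemma radius01 n : 0 <= radius n < 1.
Proof.
by rewrite /radius /harmonic/= subr_ge0 invf_le1 ?ltr0n// ler1n/= ltrBlDr ltrDl invr_gt0 ltr0n.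
Qed.

Lemma radius_cvg : radius n @[n --> \oo] --> (1 : R).
Proof.
by rewrite -[X in _ --> X]subr0; apply: cvgB; [exact: cvg_cst|exact: cvg_harmonic].
Qed.

(** For [u] reduced to [w] in [(0, 1)], the argument of the arctangent tends to
[cot (pi w) = tan (pi / 2 - pi w)]; at the integers all values are 0, which is
where the middle value of the staircase is used. *)
Lemma argk_lim u : argk (radius n) u @[n --> \oo] --> pi * (stair u - u).
Proof.
have [ui|ui] := boolP (u \is a Num.int).
  have fu : (Num.floor u)%:~R = u :> R by apply/eqP; rewrite -intrEfloor.
  have -> : stair u - u = 0 by rewrite /stair ceil_floor ui addr0 fu; field.
  have s0 : sin (2 * pi * u) = 0.
    rewrite -fu; case: (Num.floor u) => k.
      by have := (cos_sin_addn (0 : R) k).2; rewrite add0r sin0.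
    have := (cos_sin_addn (- (2 * pi * k.+1%:R) : R) k.+1).2; rewrite addNr sin0 NegzE.
    by rewrite mulrNz mulrN => <-.
  rewrite mulr0; apply: cvg_near_cst; apply: nearW => n.
  by rewrite /argk s0 mulr0 mul0r atan0.
pose w := u - (Num.floor u)%:~R.
have /andP[w0 w1] : 0 < w < 1.
  have /andP[f1 f2] := floor_itv u; rewrite /w ltrBlDl; move: f2; rewrite intrD => ->.
  rewrite andbT subr_gt0 lt_neqAle f1 andbT.
  by apply: contra ui => /eqP E; rewrite intrEfloor E.
have E : pi * (stair u - u) = pi / 2 - pi * w.
  by rewrite /stair ceil_floor ui intrD /w/=; field.
have pp := @pi_gt0 R.
have CS : cos (2 * pi * u) = cos (2 * (pi * w)) /\ sin (2 * pi * u) = sin (2 * (pi * w)).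
  rewrite /w; case: (Num.floor u) => k.
    have := cos_sin_addn (2 * (pi * (u - k%:R))) k.
    by have -> : 2 * (pi * (u - k%:R)) + 2 * pi * k%:R = 2 * pi * u by ring.
  have := cos_sin_addn (2 * pi * u) k.+1; rewrite NegzE mulrNz opprK.
  have -> : 2 * (pi * (u + k.+1%:R)) = 2 * pi * u + 2 * pi * k.+1%:R by ring.
  by case=> -> ->.
have sw : 0 < sin (pi * w).
  by rewrite sin_gt0_pi// mulr_gt0//= gtr_pMr.
have cs := cos2Dsin2 (pi * w).
have c2 : cos (2 * pi * u) = 1 - 2 * sin (pi * w) ^+ 2.
  rewrite CS.1 mulr_natl mulr2n cosD.
  have -> : cos (pi * w) * cos (pi * w) - sin (pi * w) * sin (pi * w) =
    cos (pi * w) ^+ 2 + sin (pi * w) ^+ 2 - 2 * sin (pi * w) ^+ 2 by ring.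
  by rewrite cs.
have s2 : sin (2 * pi * u) = 2 * (sin (pi * w) * cos (pi * w)).
  by rewrite CS.2 mulr_natl mulr2n sinD; ring.
have L : radius n * sin (2 * pi * u) / (1 - radius n * cos (2 * pi * u)) @[n --> \oo] -->
    1 * sin (2 * pi * u) / (1 - 1 * cos (2 * pi * u)).
  have rc := radius_cvg.
  apply: cvgM; first exact: cvgMl.
  apply: cvgV; last by apply: cvgB; [exact: cvg_cst|exact: cvgMl].
  by rewrite mul1r c2 opprB addrC subrK mulf_neq0// expf_neq0// gt_eqF.
have := @continuous_cvg _ _ _ _ _ _ (@atan R) _ (@continuous_atan R _) L.
suff -> : pi * (stair u - u) = atan (1 * sin (2 * pi * u) / (1 - 1 * cos (2 * pi * u))) by apply.
have -> : 1 * sin (2 * pi * u) / (1 - 1 * cos (2 * pi * u)) = tan (pi / 2 - pi * w).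
  rewrite /tan sinB cosB sin_pihalf cos_pihalf !mul1r !mul0r add0r subr0 c2 s2.
  move: (sin (pi * w)) (cos (pi * w)) sw => s' c' s0.
  have -> : 1 - (1 - 2 * s' ^+ 2) = 2 * s' ^+ 2 by ring.
  by field; rewrite gt_eqF.
rewrite tanK ?E// in_itv/=; have : pi * w < pi by rewrite gtr_pMr.
by have : 0 < pi * w by [rewrite mulr_gt0]; move: (pi * w) (pi : R) => a b; lra.
Qed.

(** The positive part of [log |Q (r e(x))|], where [Q] has the roots [e(b)]. *)
Definition logp_prod bs r x : R :=
  ln (Num.max 1 (\prod_(b <- bs) (1 - 2 * r * cos (2 * pi * (x - b)) + r ^+ 2))) / 2.

Lemma cont_prod (I : Type) (s : seq I) (f : I -> R -> R) :
  (forall i, continuous (f i)) -> continuous (fun x => \prod_(i <- s) f i x).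
Proof.
move=> cf x; apply: cvg_big => //; first exact: mul_continuous.
by move=> i _; apply: cf.
Qed.

Lemma max1_gt0 x : 0 < Num.max 1 x. Proof. by rewrite lt_max ltr01. Qed.

Lemma logp_prod_cont bs r : continuous (logp_prod bs r).
Proof.
apply: contM; last exact: contcst.
apply: contln => [|x]; last exact: max1_gt0.
by apply: contmax; [exact: contcst|apply: cont_prod => b; cont].
Qed.

Lemma sum_logk bs r x : 0 <= r < 1 ->
  Num.max (\sum_(b <- bs) logk r (x - b)) 0 = logp_prod bs r x.
Proof.
move=> r01; set p := \prod_(b <- bs) (1 - 2 * r * cos (2 * pi * (x - b)) + r ^+ 2).
have [p0 ->] : 0 < p /\ \sum_(b <- bs) logk r (x - b) = ln p / 2.
  rewrite {}/p; elim: bs => [|b bs [p0 IH]]; first by rewrite !big_nil ln1 mul0r.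
  have d0 := den_gt0 (2 * pi * (x - b)) r01.
  rewrite !big_cons IH lnM ?posrE//; split; first exact: mulr_gt0.
  by rewrite [RHS]mulrDl.
rewrite /logp_prod -/p; have [p1|p1] := leP 1 p.
  by rewrite (max_l (x:=_/2))// divr_ge0// ln_ge0.
by rewrite ln1 mul0r max_r// pmulr_lle0// ln_le0// ltW.
Qed.

Lemma logp_prod_bound bs r x : 0 <= r <= 1 ->
  0 <= logp_prod bs r x <= ln (4 ^+ size bs) / 2.
Proof.
move=> /andP[r0 r1]; rewrite divr_ge0 ?ln_ge0 ?le_max ?lexx//=.
rewrite ler_pM2r// ler_ln ?posrE ?max1_gt0 ?exprn_gt0//.
rewrite ge_max exprn_ege1//=; last lra.
elim: bs => [|b bs IH]; first by rewrite big_nil.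
rewrite big_cons /= [leRHS]exprS ler_pM//.
- by apply: le_trans (den_ge _ r0); rewrite sqr_ge0.
- rewrite prodr_ge0// => i _; apply: le_trans (den_ge _ r0); exact: sqr_ge0.
- by have := cos_geN1 (2 * pi * (x - b)); nra.
Qed.

Lemma logp_prod_lim bs x : logp_prod bs (radius n) x @[n --> \oo] --> logp_prod bs 1 x.
Proof.
apply: cvgMl.
apply: (@continuous_cvg _ _ _ _ _ _ (@ln R)); first by apply: continuous_ln; exact: max1_gt0.
have cm : continuous (fun z : R => Num.max 1 z) by cont.
apply: (@continuous_cvg _ _ _ _ _ _ (fun z : R => Num.max 1 z)); first exact: cm.
apply: cvg_big => //; first exact: mul_continuous.
move=> b _; have rc := radius_cvg.
have ck : continuous (fun r => 1 - 2 * r * cos (2 * pi * (x - b)) + r ^+ 2) by cont.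
exact: (@continuous_cvg _ _ _ _ _ radius (fun r => 1 - 2 * r * cos (2 * pi * (x - b)) + r ^+ 2) 1 (ck 1)).
Qed.

Lemma itg_logp_prod_lim bs :
  itg 0 1 (logp_prod bs (radius n)) @[n --> \oo] --> itg 0 1 (logp_prod bs 1).
Proof.
have := @itg_lim R 0 1 (fun n => logp_prod bs (radius n)) (logp_prod bs 1) (ln (4 ^+ size bs) / 2).
case=> [n|n x _|x|//]; first exact: logp_prod_cont.
  have /andP[r0 r1] := radius01 n.
  have /andP[h1 h2] := @logp_prod_bound bs (radius n) x ltac:(by rewrite r0 ltW).
  by rewrite ger0_norm.
exact: logp_prod_lim.
Qed.

Lemma logk_period r u : logk r (u + 1) = logk r u.
Proof.
rewrite /logk; have -> : 2 * pi * (u + 1) = 2 * pi * u + 2 * pi * 1%:R by ring.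
by rewrite (cos_sin_addn _ 1).1.
Qed.

(** As [log |Q (r e(x))|] has mean 0, the integral of its absolute value is
twice that of its positive part. *)
Lemma itg_norm_logk l r bs c : 0 < l -> 0 <= r < 1 ->
  itg (- (l / 2)) (l / 2) (fun x => `|\sum_(b <- bs) logk r (x / l - (b - c))|) =
  2 * l * itg 0 1 (logp_prod bs r).
Proof.
move=> l0 r01; have cl := logk_cont r01.
have ll : - (l / 2) <= l / 2 by lra.
pose g x := \sum_(b <- bs) logk r (x / l - (b - c)).
have cg : continuous g by rewrite /g; cont.
have g0 : itg (- (l / 2)) (l / 2) g = 0.
  rewrite /g itg_sum; last by move=> b; cont.
  by rewrite big1// => b _; exact: itg_logk.
transitivity (2 * itg (- (l / 2)) (l / 2) (fun x => Num.max (g x) 0) - itg (- (l / 2)) (l / 2) g).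
  rewrite -itgZ; last by cont.
  rewrite -itgB; [|by cont|by cont].
  apply: eq_itg => x _; rewrite -/(g x); have [gx|gx] := leP (g x) 0.
    by rewrite ler0_norm//; ring.
  by rewrite gtr0_norm//; ring.
rewrite g0 subr0 -mulrA; congr (2 * _).
have cp := @logp_prod_cont bs r.
rewrite (@eq_itg _ _ _ _ (fun x => logp_prod bs r (l^-1 * x + c))); last first.
  move=> x _; rewrite -(sum_logk _ _ r01) /g; congr (Num.max _ 0).
  by apply: eq_bigr => b _; congr (logk r _); ring.
rewrite (@itg_aff _ _ _ l^-1 c)//; last by rewrite invr_gt0.
rewrite invrK; congr (l * _).
have -> : l^-1 * (l / 2) + c = l^-1 * - (l / 2) + c + 1 by field; rewrite gt_eqF.
apply: itg_period => // x; rewrite -!(sum_logk _ _ r01); congr (Num.max _ 0).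
by apply: eq_bigr => b _; rewrite addrAC logk_period.
Qed.

Lemma argk_le r u : `|argk r u| <= pi.
Proof.
have p2 : pi / 2 <= pi :> R by rewrite ler_pdivrMr// ler_peMr ?ler1n// ltW// pi_gt0.
rewrite ler_norml; apply/andP; split; last exact: le_trans (ltW (atan_ltpi2 _)) p2.
by apply: le_trans (ltW (atan_gtNpi2 _)); rewrite lerN2.
Qed.

Variable F : R -> R.
Hypothesis Fcont : continuous F.
Hypothesis Feven : forall x, F (- x) = F x.
Hypothesis Fge0 : forall x, 0 <= F x.
Hypothesis Fsupp : forall y, ~~ (- 2^-1 < y < 2^-1) -> F y = 0.
Hypothesis Fint : mu.-integrable setT (EFin \o cosT F).

Variable M : R.
Hypothesis hL : {ae mu, forall x, `|hilbertL F x| <= M}.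
Hypothesis hC : {ae mu, forall x, 0 < x < 2^-1 -> `|hilbertC F 1 x| <= M}.

(** [argk_bound] for the angles translated by [c], in the limit: the left-hand
side converges by [argk_lim], and the right-hand side, rewritten by
[itg_norm_logk] in terms of the positive part of the logarithm, has no
singularity left at radius 1. *)
Lemma stair_bound l bs c : 1 < l ->
  let g t := F t * \sum_(b <- bs) (stair (b - c - t / l) - (b - c - t / l)) in
  mu.-integrable `[- 2^-1, 2^-1] (EFin \o g) /\
  `|IF g| <= 2 * M * l / pi * itg 0 1 (logp_prod bs 1).
Proof.
move=> l1 g; have l0 : 0 < l by lra.
have pp := @pi_gt0 R.
have [KF KF0 hF] := F_bounded Fcont Fsupp.
pose f n t := F t * \sum_(b <- bs) (pi^-1 * argk (radius n) (b - c - t / l)).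
have cf n : continuous (f n) by have ca := argk_cont (radius01 n); rewrite /f; cont.
have fK n t : - 2^-1 <= t <= 2^-1 -> `|f n t| <= KF * (size bs)%:R.
  move=> _; rewrite normrM ler_pM//.
  rewrite (le_trans (ler_norm_sum _ _ _))//.
  apply: (@le_trans _ _ (\sum_(b <- bs) (1 : R))); last first.
    by rewrite big_const_seq count_predT iter_addr_0.
  apply: ler_sum => b _; rewrite normrM gtr0_norm ?invr_gt0//.
  by rewrite mulrC ler_pdivrMr// mul1r argk_le.
have fg t : f n t @[n --> \oo] --> g t.
  apply: cvgMr; apply: cvg_big => //; first exact: add_continuous.
  move=> b _; set u := b - c - t / l.
  have -> : stair u - u = pi^-1 * (pi * (stair u - u)) by rewrite mulKf// gt_eqF.
  by apply: cvgMr; exact: argk_lim.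
have [gi gc] := itg_lim cf fK fg; split=> //.
have pc := @itg_logp_prod_lim bs.
have pc' : 2 * M * l / pi * itg 0 1 (logp_prod bs (radius n)) @[n --> \oo] -->
    2 * M * l / pi * itg 0 1 (logp_prod bs 1) by exact: cvgMr pc.
apply: (ler_cvg_to (cvg_norm gc) pc').
apply: nearW => n.
have := argk_bound Fcont Feven Fge0 Fsupp Fint hL hC [seq b - c | b <- bs] l1 (radius01 n).
under eq_itg do rewrite big_map.
under [X in _ <= _ * X]eq_itg do rewrite big_map.
rewrite itg_norm_logk ?radius01// => h.
have ca := argk_cont (radius01 n).
rewrite (_ : itg _ _ (f n) = pi^-1 * itg (- 2^-1) 2^-1 (fun t => F t * \sum_(b <- bs) argk (radius n) (b - c - t / l))).
  rewrite normrM gtr0_norm ?invr_gt0// -ler_pdivlMl ?invr_gt0// invrK.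
  apply: le_trans h _; rewrite le_eqVlt; apply/orP; left; apply/eqP.
  move: (itg _ _ (logp_prod _ _)) (pi : R) pp => X p p0.
  by field; rewrite gt_eqF.
rewrite -itgZ; last by cont.
by apply: eq_itg => t _; rewrite /f -mulr_sumr mulrCA.
Qed.
End RadialLimit.

(** * Counting angles by smoothed staircases *)

Section Counting.
Context {R : realType}.
Implicit Types (u v x y t b c l r : R) (bs : seq R).
Local Notation mu := (@lebesgue_measure R).
Local Notation IF g := (itg (- 2^-1) 2^-1 g).

Lemma le_stair u v : u <= v -> stair u <= stair v.
Proof.
by move=> uv; rewrite /stair ler_pM2r// lerD// ler_int; [exact: le_floor|exact: le_ceil].
Qed.

Lemma stairDz u (n : int) : stair (u + n%:~R) = stair u + n%:~R.
Proof.
have ni : (n%:~R : R) \is a Num.int by exact: intr_int.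
by rewrite /stair floorDrz// ceilDrz// intrKfloor intrKceil !intrD; field.
Qed.

Lemma stair_gt0 u : 0 < u -> 2^-1 <= stair u.
Proof.
move=> u0; have h1 : 0 <= (Num.floor u)%:~R :> R by rewrite ler0z floor_ge0 ltW.
have h2 : 1 <= (Num.ceil u)%:~R :> R by rewrite ler1z -gtz0_ge1 ceil_gt0.
by rewrite /stair; lra.
Qed.

Lemma stair_lt0 u : u < 0 -> stair u <= - 2^-1.
Proof.
move=> u0; have h1 : (Num.ceil u)%:~R <= 0 :> R by rewrite lerz0 ceil_le0 ltW.
have h2 : (Num.floor u)%:~R <= -1 :> R.
  by rewrite -mulrN1z ler_int -ltzD1 addNr floor_lt0.
by rewrite /stair; lra.
Qed.

(** The staircase is constant between integers. *)
Lemma stair_jump u v : u <= v -> stair u < stair v -> exists n : int, u <= n%:~R <= v.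
Proof.
move=> uv suv; exists (Num.ceil u); rewrite ceil_ge/=.
rewrite leNgt; apply/negP => vc; move: suv; apply/negP; rewrite -leNgt.
have c1 : Num.ceil v <= Num.ceil u by rewrite ceil_le_int ltW.
have f1 : Num.floor v <= Num.floor u.
  have [ui|ui] := boolP (u \is a Num.int).
    by move: vc; rewrite ceil_floor ui addr0 floorK// ltNge uv.
  by rewrite -ltzD1; have := ceil_floor u; rewrite ui/= => <-; rewrite floor_lt_int.
by rewrite /stair ler_pM2r// lerD// ler_int.
Qed.

Section Interval.
Variables (x y : R) (cnt : pred R).
Hypotheses (xy : x <= y) (yx1 : y <= x + 1).
Hypothesis cntU : forall th, cnt th -> exists n : int, x <= th + n%:~R <= y.
Hypothesis cntL : forall th (n : int), x < th + n%:~R < y -> cnt th.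

(** The difference of staircases is at least 1 at the points of the enlarged
interval, and nonnegative elsewhere. *)
Lemma count_upper th s d : `|s| < d / 2 ->
  (cnt th)%:R <= stair (th - (x - d / 2) - s) - stair (th - (y + d / 2) - s).
Proof.
rewrite ltr_norml => /andP[s1 s2].
case: (boolP (cnt th)) => [/cntU[n /andP[n1 n2]]|_] /=.
  rewrite -[X in X - _](addrK n%:~R) -[X in _ - X](addrK n%:~R) -!stairDz.
  have := @stair_gt0 (th - (x - d / 2) - s + n%:~R) ltac:(lra).
  have := @stair_lt0 (th - (y + d / 2) - s + n%:~R) ltac:(lra).
  by lra.
have h1 := xy; have h2 := yx1; by rewrite subr_ge0 le_stair//; lra.
Qed.

(** For the shrunk interval the difference is at most 1, as [y - x <= 1], and
when it is positive an integer translate of [th] lies in the interior of the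
original interval. *)
Lemma count_lower th s d : `|s| < d / 2 -> d <= y - x ->
  stair (th - (x + d / 2) - s) - stair (th - (y - d / 2) - s) <= (cnt th)%:R.
Proof.
rewrite ltr_norml => /andP[s1 s2] dxy.
set p := th - (x + d / 2) - s; set q := th - (y - d / 2) - s.
have qp : q <= p by rewrite /p /q; lra.
have pq1 : stair p <= stair q + 1.
  have h1 := yx1; have := stairDz q 1; rewrite /= => <-; apply: le_stair.
  by rewrite /p /q; lra.
have [ss|ss] := leP (stair p) (stair q).
  by apply: (@le_trans _ _ 0); rewrite ?subr_le0// ler0n.
have [n /andP[n1 n2]] := stair_jump qp ss.
rewrite (@cntL th (- n)); first by rewrite /=; lra.
by rewrite intrN; rewrite /p /q in n1 n2; apply/andP; split; lra.
Qed.

Variable F : R -> R.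
Hypothesis Fcont : continuous F.
Hypothesis Feven : forall x, F (- x) = F x.
Hypothesis Fge0 : forall x, 0 <= F x.
Hypothesis Fsupp : forall y, ~~ (- 2^-1 < y < 2^-1) -> F y = 0.
Hypothesis Fint : mu.-integrable setT (EFin \o cosT F).

Variable M : R.
Hypothesis hL : {ae mu, forall x, `|hilbertL F x| <= M}.
Hypothesis hC : {ae mu, forall x, 0 < x < 2^-1 -> `|hilbertC F 1 x| <= M}.

(** With [s = t / l] and [d = 1 / l] in [count_upper] and [count_lower], the
hypothesis [|s| < d / 2] describes the support of [F]. In a difference of two
sums of [stair u - u] the linear parts contribute the number of angles times the
length of the enlarged or shrunk interval. *)
Lemma count_bound l bs : 1 < l -> 0 < IF F ->
  `|(count cnt bs)%:R - (y - x) * (size bs)%:R| <=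
    (size bs)%:R / l + 4 * M * l / (pi * IF F) * itg 0 1 (logp_prod bs 1).
Proof.
move=> l1 m0; have l0 : 0 < l by lra.
have pp := @pi_gt0 R.
set m := IF F; set h := itg 0 1 _; set N := (size bs)%:R : R.
pose g c t := F t * \sum_(b <- bs) (stair (b - c - t / l) - (b - c - t / l)).
pose K := 2 * M * l / pi * h.
have gi c : mu.-integrable `[- 2^-1, 2^-1] (EFin \o g c) by exact: (stair_bound Fcont Feven Fge0 Fsupp Fint hL hC bs c l1).1.
have gK c : `|IF (g c)| <= K by exact: (stair_bound Fcont Feven Fge0 Fsupp Fint hL hC bs c l1).2.
have Fi := cont_int (- 2^-1) 2^-1 Fcont.
have tl t : F t != 0 -> `|t / l| < l^-1 / 2.
  move=> Ft; have : - 2^-1 < t < 2^-1 by apply: contraNT Ft => /Fsupp ->.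
  by rewrite -ltr_norml normrM normfV (gtr0_norm l0) mulrC ltr_pM2l ?invr_gt0.
have cE : (count cnt bs)%:R = \sum_(b <- bs) (cnt b)%:R :> R.
  by rewrite -sum1_count big_mkcond natr_sum; apply: eq_bigr => b _; case: (cnt b).
have NE (k : R) : k * N = \sum_(b <- bs) k.
  by rewrite big_const_seq count_predT iter_addr_0 mulr_natr.
have sumE c c' t : g c t - g c' t = F t * (\sum_(b <- bs) (stair (b - c - t / l) - stair (b - c' - t / l)) - (c' - c) * N).
  rewrite /g -mulrBr -sumrB NE -sumrB; congr (_ * _); apply: eq_bigr => b _; ring.
have lin (k : R) c c' :
   \int[mu]_(t in `[- 2^-1, 2^-1]) (k * F t + (g c t - g c' t)) = k * m + (IF (g c) - IF (g c')).
  rewrite RintegralD//.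
  - by rewrite RintegralZl// RintegralB.
  - exact: cont_int (contM (contcst (k:=k)) Fcont).
  - exact: (integrableB _ (gi c) (gi c')).
have mK : 2 * K / m = 4 * M * l / (pi * m) * h.
  rewrite /K; move: (pi : R) pp => p p0; field; rewrite !gt_eqF//.
have K0 : 0 <= K by apply: le_trans (gK 0); exact: normr_ge0.
have bnd c c' : IF (g c) - IF (g c') <= 2 * K.
  by have := gK c; have := gK c'; rewrite !ler_norml; lra.
have U : (count cnt bs)%:R - (y - x) * N <= N / l + 2 * K / m.
  pose c := x - l^-1 / 2; pose c' := y + l^-1 / 2.
  have : 0 <= \int[mu]_(t in `[- 2^-1, 2^-1]) (((c' - c) * N - (count cnt bs)%:R) * F t + (g c t - g c' t)).
    apply: Rintegral_ge0 => t _; rewrite sumE [_ * F t]mulrC -mulrDr.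
    have [->|Ft] := eqVneq (F t) 0; first by rewrite mul0r.
    rewrite mulr_ge0// addrC subrKA subr_ge0 cE ler_sum// => b _.
    exact: count_upper (tl t Ft).
  rewrite lin => h1; have h2 := bnd c c'.
  rewrite -lerBlDl ler_pdivlMr//; move: h1 h2; rewrite /c /c'.
  by move: (IF (g _) - _) => I; nra.
have L : - (N / l + 2 * K / m) <= (count cnt bs)%:R - (y - x) * N.
  (* An interval shorter than [1 / l] cannot be shrunk, but then the first error
term alone is large enough. *)
have [dl|dl] := leP l^-1 (y - x); last first.
    have h1 : 0 <= (count cnt bs)%:R :> R by rewrite ler0n.
    have h2 : 0 <= 2 * K / m by apply: divr_ge0; [exact: mulr_ge0|exact: ltW].
    have h3 : (y - x) * N <= N / l by rewrite mulrC ler_wpM2l ?ler0n// ltW.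
    by lra.
  pose c := x + l^-1 / 2; pose c' := y - l^-1 / 2.
  have : 0 <= \int[mu]_(t in `[- 2^-1, 2^-1]) (((count cnt bs)%:R - (c' - c) * N) * F t + (g c' t - g c t)).
    apply: Rintegral_ge0 => t _; rewrite sumE [_ * F t]mulrC -mulrDr.
    have [->|Ft] := eqVneq (F t) 0; first by rewrite mul0r.
    rewrite mulr_ge0// -(opprB c' c) mulNr opprK addrACA addNr addr0.
    rewrite cE -big_split/= sumr_ge0// => b _.
    by have := count_lower b (tl t Ft) dl; rewrite /c /c'; lra.
  rewrite lin => h1; have h2 := bnd c' c.
  rewrite lerNl opprB -lerBlDl ler_pdivlMr//; move: h1 h2; rewrite /c /c'.
  by move: (IF (g _) - _) => I; nra.
by rewrite ler_norml -mK L U.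
Qed.
End Interval.
End Counting.

(** * Roots and height of the polynomial *)

Local Notation normc := Normc.normc.

Section Roots.
Context {R : realType}.
Implicit Types (P : {poly R[i]}) (z : R[i]) (t x y : R).

Lemma normc_ge0 z : 0 <= normc z.
Proof. by case: z => a b; exact: sqrtr_ge0. Qed.

Lemma sqr_normc_def (a b : R) : normc (a +i* b) ^+ 2 = a ^+ 2 + b ^+ 2.
Proof. by rewrite /normc sqr_sqrtr// addr_ge0// sqr_ge0. Qed.

Lemma cis_surj z : exists t, z = (normc z)%:C * cis t.
Proof.
have [->|z0] := eqVneq z 0; first by exists 0; rewrite Normc.normc0 mul0r.
have n0 : 0 < normc z.
  by rewrite lt_neqAle normc_ge0 andbT eq_sym; apply: contra z0 => /eqP/Normc.eq0_normc ->.
have := sqr_normc_def (complex.Re z) (complex.Im z).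
case: z z0 n0 => a b /= z0 n0; set rho := Num.sqrt _ in n0 * => E.
pose c := a / rho; pose s := b / rho.
have cs : c ^+ 2 + s ^+ 2 = 1.
  by rewrite /c /s !expr_div_n -mulrDl -E divff// expf_neq0// gt_eqF.
have c1 : -1 <= c <= 1 by have := sqr_ge0 s; nra.
have cc : cos (acos c) = c by rewrite acosK.
have ss : sin (acos c) ^+ 2 = s ^+ 2.
  by have := cos2Dsin2 (acos c); rewrite cc -cs => /addrI.
have sp : 0 <= sin (acos c) by apply: sin_ge0_pi; rewrite acos_ge0// acos_lepi.
have pp := @pi_gt0 R.
have k (v : R) : 2 * pi * (v / (2 * pi)) = v.
  by rewrite mulrC divfK// gt_eqF// mulr_gt0.
have [s0|s0] := leP 0 s.
  exists (acos c / (2 * pi)); rewrite /cis k cc.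
  have -> : sin (acos c) = s by apply/eqP; rewrite -(eqrXn2 (n := 2))// ss.
  by simpc; rewrite /c /s ![rho * _]mulrC !divfK// gt_eqF.
exists (- acos c / (2 * pi)); rewrite /cis k cosN sinN cc.
have -> : - sin (acos c) = s.
  apply/eqP; rewrite -eqr_opp opprK -(eqrXn2 (n := 2))// ?oppr_ge0 ?(ltW s0)//.
  by rewrite sqrrN ss.
by simpc; rewrite /c /s ![rho * _]mulrC !divfK// gt_eqF.
Qed.

Definition angle z : R := sval (cid (cis_surj z)).

Lemma angleE z : z = (normc z)%:C * cis (angle z).
Proof. by rewrite /angle; case: cid. Qed.

Lemma cis_inj t x : cis t = cis x -> exists n : int, t = x + n%:~R.
Proof.
case=> E1 E2; pose u := t - x.
have cu : cos (2 * pi * u) = 1.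
  by rewrite /u mulrBr cosB E1 E2 -!expr2 cos2Dsin2.
exists (Num.floor u).
pose w := u - (Num.floor u)%:~R.
have cw : cos (2 * (pi * w)) = 1.
  transitivity (cos (2 * pi * u)) => //; rewrite /w; case: (Num.floor u) => k.
    rewrite -pmulrn -(cos_sin_addn (2 * (pi * (u - k%:R))) k).1.
    by congr cos; ring.
  rewrite NegzE mulrNz opprK -(cos_sin_addn (2 * pi * u) k.+1).1.
  by congr cos; ring.
have /andP[w0 w1] : 0 <= w < 1.
  have /andP[f1 f2] := floor_itv u; rewrite /w subr_ge0 f1 ltrBlDl.
  by move: f2; rewrite intrD.
have [wz|wz] := eqVneq w 0.
  by apply/eqP; rewrite addrC -subr_eq; apply/eqP/subr0_eq; rewrite -[RHS]wz /w /u.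
have pp := @pi_gt0 R.
have wp : 0 < w by rewrite lt_neqAle w0 eq_sym wz.
have : 0 < sin (pi * w) by rewrite sin_gt0_pi// mulr_gt0//= gtr_pMr.
move: cw; rewrite mulr_natl mulr2n cosD.
by have := cos2Dsin2 (pi * w); nra.
Qed.

Lemma cis_addz t (n : int) : cis (t + n%:~R) = cis t.
Proof.
rewrite /cis; case: n => k.
  rewrite -pmulrn; have -> : 2 * pi * (t + k%:R) = 2 * pi * t + 2 * pi * k%:R by ring.
  by have [-> ->] := cos_sin_addn (2 * pi * t) k.
rewrite NegzE mulrNz -pmulrn.
have [<- <-] := cos_sin_addn (2 * pi * (t - k.+1%:R)) k.+1.
by congr (cos _ +i* sin _); ring.
Qed.

Lemma normc_cisB z t : normc (cis t - z) ^+ 2 =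
  1 - 2 * normc z * cos (2 * pi * (t - angle z)) + normc z ^+ 2.
Proof.
rewrite [in LHS](angleE z); move: (normc z) (angle z) => rho b.
rewrite /cis; simpc; rewrite sqr_normc_def (mulrBr (2 * pi)) cosB.
have h1 := cos2Dsin2 (2 * pi * t); have h2 := cos2Dsin2 (2 * pi * b).
move: (cos (2 * pi * t)) (sin (2 * pi * t)) (cos (2 * pi * b)) (sin (2 * pi * b)) h1 h2.
move=> a b1 c d h1 h2.
transitivity (a ^+ 2 + b1 ^+ 2 - 2 * rho * (a * c + b1 * d) + rho ^+ 2 * (c ^+ 2 + d ^+ 2)).
  by ring.
by rewrite h1 h2 mulr1.
Qed.

Lemma normc_prod (s : seq R[i]) (f : R[i] -> R[i]) :
  normc (\prod_(z <- s) f z) = \prod_(z <- s) normc (f z).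
Proof.
elim: s => [|z s IH]; first by rewrite !big_nil Normc.normc1.
by rewrite !big_cons Normc.normcM IH.
Qed.

Lemma rootsE P : P \is monic -> P = \prod_(z <- roots P) ('X - z%:P).
Proof.
move=> /monicP Pm; rewrite [LHS](svalP (closed_field_poly_normal P)).
by rewrite -/(roots P) Pm scale1r.
Qed.

Section MonicPoly.
Variable P : {poly R[i]}.
Hypothesis Pm : P \is monic.
Hypothesis P0 : P.[0] != 0.

Let bs : seq R := [seq angle z | z <- roots P].

Lemma size_roots : size (roots P) = (size P).-1.
Proof. by rewrite [in RHS](rootsE Pm) size_prod_XsubC. Qed.

Lemma root_neq0 z : z \in roots P -> z != 0.
Proof.
move=> zP; apply: contra P0 => /eqP z0; rewrite (rootsE Pm) -/(root _ 0) root_prod_XsubC.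
by rewrite -z0.
Qed.

Lemma normc_horner t : normc P.[cis t] = \prod_(z <- roots P) normc (cis t - z).
Proof.
rewrite [in LHS](rootsE Pm) horner_prod normc_prod.
by apply: eq_bigr => z _; rewrite hornerXsubC.
Qed.

Lemma normc_coef0 : normc P`_0 = \prod_(z <- roots P) normc z.
Proof.
rewrite -horner_coef0 [in LHS](rootsE Pm) horner_prod normc_prod.
by apply: eq_bigr => z _; rewrite hornerXsubC sub0r; case: (z) => a b; rewrite /= !sqrrN.
Qed.

Lemma normc_gt0 z : z != 0 -> 0 < normc z.
Proof.
move=> z0; rewrite lt_neqAle normc_ge0 andbT eq_sym.
by apply: contra z0 => /eqP/Normc.eq0_normc ->.
Qed.

Lemma normc_coef0_gt0 : 0 < normc P`_0.
Proof. by rewrite normc_gt0// -horner_coef0. Qed.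

(** Moving the roots radially to the unit circle only decreases the normalized
modulus on the circle, as [2 <= rho + 1 / rho]. *)
Lemma schur t :
  \prod_(b <- bs) (1 - 2 * 1 * cos (2 * pi * (t - b)) + 1 ^+ 2) <=
  (normc P.[cis t] / Num.sqrt (normc P`_0)) ^+ 2.
Proof.
rewrite expr_div_n sqr_sqrtr ?normc_ge0// ler_pdivlMr ?normc_coef0_gt0//.
rewrite normc_horner normc_coef0 big_map -prodrXl -big_split/=.
apply: ler_prod => z _; rewrite normc_cisB.
have h1 := cos_le1 (2 * pi * (t - angle z)); have h2 := normc_ge0 z.
rewrite expr1n mulr1; have h3 := sqr_ge0 (1 - normc z).
move: (cos _) (normc z) h1 h2 h3 => c rho h1 h2 h3.
by apply/andP; split; [rewrite mulr_ge0//; lra|nra].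
Qed.

Definition log_height t : R := logp (normc P.[cis t] / Num.sqrt (normc P`_0)).

Lemma logpE x : 0 <= x -> logp x = ln (Num.max 1 x).
Proof.
move=> x0; rewrite /logp; have [x1|x1] := leP 1 x.
  by rewrite max_l// ln_ge0.
by rewrite ln1 max_r// ln_le0// ltW.
Qed.

Lemma log_heightE t : log_height t = ln (Num.max 1 (normc P.[cis t] / Num.sqrt (normc P`_0))).
Proof. by rewrite /log_height logpE// divr_ge0 ?normc_ge0// sqrtr_ge0. Qed.

Lemma log_height_cont : continuous log_height.
Proof.
have -> : log_height = fun t => ln (Num.max 1 ((\prod_(z <- roots P) Num.sqrt (1 - 2 * normc z * cos (2 * pi * (t - angle z)) + normc z ^+ 2)) / Num.sqrt (normc P`_0))).
  apply/funext => t; rewrite log_heightE normc_horner; congr (ln (Num.max 1 (_ / _))).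
  by apply: eq_bigr => z _; rewrite -normc_cisB sqrtr_sqr ger0_norm ?normc_ge0.
apply: contln => [|t]; last exact: max1_gt0.
apply: contmax; first exact: contcst.
apply: contM; last exact: contcst.
apply: cont_prod => z.
have sc : continuous (@Num.sqrt R) by exact: sqrt_continuous.
by cont.
Qed.

Lemma logp_prod_le t : logp_prod bs 1 t <= log_height t.
Proof.
rewrite log_heightE /logp_prod; have := schur t.
have := divr_ge0 (normc_ge0 P.[cis t]) (sqrtr_ge0 (normc P`_0)).
move: (\prod_(b <- bs) _) (_ / _) => p x x0 px.
rewrite ler_pdivrMr// mulr_natr -lnXn ?max1_gt0// ler_ln ?posrE ?exprn_gt0 ?max1_gt0//.
rewrite ge_max exprn_ege1 ?le_max ?lexx//= (le_trans px)//.
by rewrite lerXn2r ?nnegrE ?le_max ?ler01 ?lexx ?orbT.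
Qed.

Lemma heightE : height P = (itg 0 1 log_height)%:E.
Proof.
rewrite /height /itg /Rintegral fineK//.
exact: (integrable_fin_num _ (cont_int 0 1 log_height_cont)).
Qed.

Lemma itg_logp_prod_le : itg 0 1 (logp_prod bs 1) <= itg 0 1 log_height.
Proof.
apply: le_itg => [||t _]; [exact: logp_prod_cont|exact: log_height_cont|exact: logp_prod_le].
Qed.

Definition hits (J : set R) : pred R := fun th => `[< exists2 t, J t & cis t = cis th >].

Lemma count_anglesE (J : set R) : count_angles P J = count (hits J) bs.
Proof.
rewrite /count_angles /bs count_map; apply: eq_in_count => z /root_neq0 z0 /=.
have nz : (normc z)%:C != 0.
  by rewrite (_ : 0 = (0 : R)%:C)// (inj_eq (@complexI R)) gt_eqF// normc_gt0.
apply: asbool_equiv_eq; split=> -[t Jt E]; exists t => //.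
  by apply: (mulfI nz); rewrite -E -angleE.
by rewrite E -angleE.
Qed.

End MonicPoly.
End Roots.

(** * The class of test functions and its Hilbert transforms *)

Section ClassA.
Context {R : realType}.
Implicit Types (F f g : R -> R) (t x y u : R).
Local Notation mu := (@lebesgue_measure R).
Local Notation IF g := (itg (- 2^-1) 2^-1 g).
Local Notation CRe := (@complex.Re R).
Local Notation CIm := (@complex.Im R).

Lemma Rintegral_supp f : (forall y, ~~ (- 2^-1 < y < 2^-1) -> f y = 0) ->
  (\int[mu]_x f x)%R = IF f.
Proof.
move=> f0; rewrite /itg [RHS]Rintegral_mkcond; congr (fine (integral _ _ _)).
apply/funext => x /=; congr (_%:E); rewrite patchE; case: ifPn => // xi.
apply: f0; apply: contra xi => /andP[/ltW x1 /ltW x2].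
by rewrite mem_set//= in_itv/= x1 x2.
Qed.

(** The support may contain the end points, but there [F] vanishes by
continuity. *)
Lemma classA_supp F : classA F -> forall y, ~~ (- 2^-1 < y < 2^-1) -> F y = 0.
Proof.
move=> [Fe Fc _ Fs _] y yi; apply/eqP/negPn/negP => Fy.
have sub z : F z != 0 -> - 2^-1 <= z <= 2^-1.
  by move=> Fz; have := Fs z (@subset_closure R [set x | F x != 0] z Fz); rewrite /= in_itv.
have edge : F 2^-1 = 0.
  apply/eqP/negPn/negP => F2.
  have : \forall z \near (2^-1 : R), F z != 0.
    exact: (cvgr_neq0 _ (Fc 2^-1) F2).
  move=> /nbhs_ballP[e /= e0 He].
  have : F (2^-1 + e / 2) != 0.
    apply: He; rewrite /ball/= opprD addrA subrr add0r normrN gtr0_norm ?divr_gt0//.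
    by rewrite ltr_pdivrMr// ltr_pMr// ltr1n.
  by move=> /sub; lra.
have := sub y Fy => /andP[y1 y2]; move: yi; rewrite negb_and -!leNgt => /orP[yi|yi].
  have E : y = - 2^-1 by lra.
  by move: Fy; rewrite E Fe edge eqxx.
have E : y = 2^-1 by lra.
by move: Fy; rewrite E edge eqxx.
Qed.

Section Member.
Variable F : R -> R.
Hypothesis FA : classA F.

Let Fcont : continuous F. Proof. by case: FA. Qed.
Let Feven : forall x, F (- x) = F x. Proof. by case: FA. Qed.
Let Fge0 : forall x, 0 <= F x. Proof. by case: FA. Qed.
Let Fsupp := classA_supp FA.

Lemma IF_sin k : IF (fun y => F y * sin (2 * pi * (k * y))) = 0.
Proof.
apply: itg_odd => //; first by cont.
by move=> y; rewrite Feven !mulrN sinN mulrN.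
Qed.

Lemma fourierE t : fourier F t = cosT F t +i* 0.
Proof.
rewrite /fourier /cintegral; congr (_ +i* _).
  rewrite Rintegral_supp => [|y /Fsupp ->]; last by rewrite /= !mulr0 subr0.
  by apply: eq_itg => y _; rewrite /= mulr0 subr0 mulrN cosN mulrC.
rewrite Rintegral_supp => [|y /Fsupp ->]; last by rewrite /= !mulr0 addr0.
rewrite -[RHS]oppr0 -(IF_sin t) -itgN; last by cont.
by apply: eq_itg => y _; rewrite /= mulr0 add0r mulrN sinN mulNr mulrC.
Qed.

Lemma cosT_int : mu.-integrable setT (EFin \o cosT F).
Proof.
case: FA => _ _ _ _ [h _]; move: h; congr (integrable _ _ _).
by apply/funext => t; rewrite fourierE.
Qed.

Lemma Re_hilbert_line x : CRe (hilbert_line F x) = hilbertL F x.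
Proof.
apply: eq_Rintegral => t _; rewrite fourierE /=.
rewrite !(mul0r, mulr0, subr0, sub0r, addr0, add0r, mulN1r, oppr0, mulNr, opprK).
case: (sgrP t) => t0.
- by rewrite !mul0r !mulr0 sin0 mulr0.
- by rewrite mul1r.
- by rewrite (mulNr t) !mulrN sinN !mulrN mulN1r mulNr.
Qed.

(** Only the translates by 0 and -1 meet the unit segment. *)
Lemma periodizationE t : 0 <= t <= 1 -> periodization F t = F t + F (t - 1).
Proof.
move=> /andP[t0 t1]; rewrite /periodization (fsbigE [:: 0; -1 : int])//=; last first.
  move=> k _; rewrite !inE negb_or => /andP[k0 k1]; apply: Fsupp.
  apply/negP => /andP[]; case: k k0 k1 => [[|k]|[|k]] // _ _; have := ler0n R k.
    by rewrite -pmulrn -(natr1 k); lra.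
  by rewrite NegzE mulrNz -pmulrn -(natr1 k.+1) -(natr1 k); lra.
by rewrite !big_cons big_nil !in_setT addr0 mulrN1z addr0.
Qed.

Lemma itg_periodization g : continuous g -> (forall x, g (x + 1) = g x) ->
  (\int[mu]_(t in `[0%R, 1%R]) (g t * periodization F t))%R = IF (fun y => F y * g y).
Proof.
move=> cg pg.
have gm x : g (x - 1) = g x by rewrite -(pg (x - 1)) subrK.
pose f y := F y * g y; have cf : continuous f by rewrite /f; cont.
transitivity (itg 0 1 (fun t => f t + f (t + -1))).
  apply: eq_Rintegral => t; rewrite inE/= in_itv/= => ti.
  by rewrite periodizationE// /f gm; ring.
rewrite itgD//; last by cont.
rewrite itg_shift// add0r subrr addrC -itg_chasles//.
rewrite (@itg_supp _ (- 2^-1) 2^-1)//; [lra|lra|lra|].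
by move=> y /Fsupp E; rewrite /f E mul0r.
Qed.

Lemma fourier_coefE (k : int) : fourier_coef (periodization F) k = cosT F k%:~R +i* 0.
Proof.
have per x : cis (k%:~R * (x + 1)) = cis (k%:~R * x) by rewrite mulrDr mulr1 cis_addz.
rewrite /fourier_coef /cintegral; congr (_ +i* _).
  transitivity (\int[mu]_(t in `[0%R, 1%R]) (cos (2 * pi * (k%:~R * t)) * periodization F t))%R.
    by apply: eq_Rintegral => t _; rewrite /= mulr0 subr0 mulrN cosN.
  rewrite itg_periodization//; first by cont.
  by move=> x; have [-> _] := per x.
transitivity (\int[mu]_(t in `[0%R, 1%R]) (- sin (2 * pi * (k%:~R * t)) * periodization F t))%R.
  by apply: eq_Rintegral => t _; rewrite /= mulr0 add0r mulrN sinN.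
rewrite itg_periodization.
- rewrite -[RHS]oppr0 -(IF_sin k%:~R) -itgN; last by cont.
  by apply: eq_itg => y _; rewrite mulrN.
- by cont.
- by move=> x; have [_ ->] := per x.
Qed.

Lemma Re_sum (I : Type) (s : seq I) (c : I -> R[i]) :
  CRe (\sum_(i <- s) c i) = \sum_(i <- s) CRe (c i).
Proof.
elim: s => [|i s IH]; first by rewrite !big_nil.
by rewrite !big_cons -IH; case: (c i) => a b; case: (\sum_(_ <- _) _).
Qed.

Lemma sum_sym_even n (h : int -> R) : h 0 = 0 -> (forall k, h (- k) = h k) ->
  \sum_(j < n.*2.+1) h (j%:Z - n%:Z) = 2 * \sum_(i < n) h i.+1%:Z.
Proof.
move=> h0 he; rewrite -addnn -addnS big_split_ord/= big_ord_recl/= addn0 subrr h0 add0r.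
rewrite mulr_natl mulr2n; congr (_ + _).
  rewrite (reindex_inj rev_ord_inj)/=; apply: eq_bigr => i _.
  by rewrite -he opprB subzn ?leq_subr// subKn.
apply: eq_bigr => i _; congr h.
by rewrite /bump/= add1n PoszD addrAC subrr add0r.
Qed.

Lemma Re_hilbert_circle x : 0 < x < 2^-1 ->
  CRe (hilbert_circle (periodization F) x) = hilbertC F 1 x.
Proof.
move=> /andP[x0 x1].
have L : conj_sum F 1 n x @[n --> \oo] --> hilbertC F 1 x.
  by apply: conj_sum_cvg => //; [exact: cosT_int|rewrite gtr0_norm//; lra].
rewrite -(cvg_lim (@Rhausdorff R) L) /hilbert_circle /csumZ /climn /=.
congr (limn _); apply/funext => n; rewrite Re_sum.
pose h (k : int) : R := (Num.sg k)%:~R * cosT F k%:~R * sin (2 * pi * (k%:~R * x)).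
rewrite (eq_bigr (fun j : 'I_ _ => h (j%:Z - n%:Z))); last first.
  move=> j _; rewrite fourier_coefE; set k : int := _ - _.
  have -> : (Num.sg k)%:~R = ((Num.sg k)%:~R : R)%:C :> R[i] by rewrite rmorph_int.
  by rewrite /h /= !(mul0r, mulr0, subr0, sub0r, addr0, add0r, mulN1r, oppr0, mulNr, opprK).
rewrite sum_sym_even.
- rewrite /conj_sum divr1; congr (_ * _); apply: eq_bigr => i _.
  by rewrite /h gtr0_sg// mul1r divr1.
- by rewrite /h sgr0 !mul0r.
- by move=> k; rewrite /h sgrN !rmorphN/= cosT_even !mulNr mulrN sinN mulrN opprK.
Qed.

Lemma normc_ge_Re (z : R[i]) : `|CRe z| <= normc z.
Proof.
case: z => a b; rewrite -sqrtr_sqr /normc/=; apply: ler_wsqrtr.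
by rewrite lerDl sqr_ge0.
Qed.

(** Both transforms are real-valued, so their real parts, identified with
[hilbertL] and [hilbertC], carry the sup norms; only an upper bound for these
real parts is extracted, from the essential supremum. *)
Lemma hilbert_bounds M :
  (Lnorm mu +oo%E (fun x => (normc (hilbert_line F x))%:E) <= M%:E)%E ->
  (Lnorm mu_circle +oo%E
     (fun x => (normc (hilbert_circle (periodization F) x))%:E) <= M%:E)%E ->
  {ae mu, forall x, `|hilbertL F x| <= M} /\
  {ae mu, forall x, 0 < x < 2^-1 -> `|hilbertC F 1 x| <= M}.
Proof.
rewrite unlock /=.
have mT : (0 < mu [set: R])%E.
  apply: (@lt_le_trans _ _ (mu `[0%R, 1%R]%classic)); last first.
    by apply: le_measure; rewrite ?inE.
  by rewrite lebesgue_measure_itv/= lte01 oppr0 adde0 lte01.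
have mC : (0 < mu_circle [set: R])%E.
  have -> : mu_circle [set: R] = mu `[0%R, 1%R]%classic.
    by rewrite /mu_circle /= /mrestr setTI.
  by rewrite lebesgue_measure_itv/= lte01 oppr0 adde0 lte01.
rewrite mT mC => h1 h2; split.
  have := ess_sup_ge mu (abse \o (fun x => (normc (hilbert_line F x))%:E)).
  apply: (@filterS _ _ (ae_filter_ringOfSetsType mu)) => x /= hx.
  rewrite -Re_hilbert_line (le_trans (normc_ge_Re _))// -lee_fin.
  by apply: le_trans h1; apply: le_trans hx; rewrite lee_fin ler_norm.
have [N [mN N0 HN]] := ess_sup_ge mu_circle
  (abse \o (fun x => (normc (hilbert_circle (periodization F) x))%:E)).
exists (N `&` `[0%R, 1%R]); split => //; first exact: measurableI.
move=> x /= /not_implyP[xi hx]; split; last by rewrite /= in_itv/=; lra.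
apply: HN => /= hN; apply: hx.
rewrite -Re_hilbert_circle// (le_trans (normc_ge_Re _))// -lee_fin.
by apply: le_trans h2; apply: le_trans hN; rewrite lee_fin ler_norm.
Qed.

Lemma Lnorm1_F : Lnorm mu 1%E (fun x => (F x)%:E) = (IF F)%:E.
Proof.
rewrite Lnorm1 -Rintegral_supp// /Rintegral fineK.
  by apply: eq_integral => x _; rewrite gee0_abs// lee_fin.
apply: integrable_fin_num => //.
have Fi := cont_int (- 2^-1) 2^-1 Fcont.
have -> : (fun x => (F x)%:E) = (EFin \o F) \_ `[- 2^-1, 2^-1].
  apply/funext => x; rewrite patchE; case: ifPn => // xi; rewrite Fsupp//.
  apply: contra xi => /andP[/ltW x1 /ltW x2].
  by rewrite mem_set//= in_itv/= x1 x2.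
by apply/(integrable_mkcond _ _).1.
Qed.

Lemma itg_classA_gt0 : F <> cst 0 -> 0 < IF F.
Proof.
move=> Fn0; have [z Fz] : exists z, F z != 0.
  apply: contrapT => /forallNP h; apply: Fn0; apply/funext => z.
  by have /negP := h z; rewrite negbK => /eqP.
have Fp : 0 < F z by rewrite lt_neqAle eq_sym Fz Fge0.
have : \forall w \near z, F z / 2 < F w.
  have Fz2 : F z / 2 < F z by lra.
  exact: (@Fcont z _ (lt_nbhsr Fz2)).
move=> /nbhs_ballP[e /= e0 He].
have big : IF F = itg (Num.min (z - e / 2) (- 2^-1)) (Num.max (z + e / 2) 2^-1) F.
  by apply/esym/itg_supp => //; rewrite ?ge_min ?le_max ?lexx ?orbT//; lra.
rewrite big (@itg_chasles _ _ (z - e / 2))//; [|by rewrite ge_min lexx|by rewrite le_max; apply/orP; left; lra].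
rewrite (@itg_chasles _ _ (z + e / 2) (Num.max _ _))//; [|lra|by rewrite le_max lexx].
have h1 : F z / 2 * e <= itg (z - e / 2) (z + e / 2) F.
  have -> : F z / 2 * e = itg (z - e / 2) (z + e / 2) (fun=> F z / 2).
    by rewrite itg_cst; [field|lra].
  apply: le_itg => // [|x /andP[x1 x2]]; first exact: contcst.
  by apply/ltW/He; rewrite /ball/= ltr_norml; lra.
have h2 : 0 <= itg (Num.min (z - e / 2) (- 2^-1)) (z - e / 2) F by apply: itg_ge0.
have h3 : 0 <= itg (z + e / 2) (Num.max (z + e / 2) 2^-1) F by apply: itg_ge0.
have h4 : 0 < F z / 2 * e by rewrite mulr_gt0// divr_gt0.
lra.
Qed.
End Member.
End ClassA.

(** * Positivity of the height and choice of the width *)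

Section Assembly.
Context {R : realType}.
Implicit Types (bs : seq R) (c x y : R).
Local Notation mu := (@lebesgue_measure R).

(** Near a zero [e(b)] of [Q], [log |Q (r e(x))|] is below [- log 2] uniformly in
[r] close to 1; as its mean is 0, its positive part cannot vanish. *)
Lemma itg_logp_prod_gt0 bs : (0 < size bs)%N -> 0 < itg 0 1 (logp_prod bs 1).
Proof.
case: bs => [//|b bs] _; set bb := b :: bs.
(* Each of the other factors contributes at most [ln 2] to the sum, so the factor
at [b] has to contribute at most [- (size bs + 1) ln 2], that is, its squared
modulus must be below [k]. *)
pose k : R := (4 ^+ (size bs).+1)^-1.
have k0 : 0 < k by rewrite invr_gt0 exprn_gt0.
have k1 : k <= 4^-1.
  by rewrite lef_pV2 ?posrE ?exprn_gt0// exprS ler_peMr// exprn_ege1//; lra.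
have pp := @pi_gt0 R; have p2 := @pi_ge2 R.
(* With this [e], both [(2 pi e)^2] and [(1 - r)^2] are at most [k / 16] as soon
as [1 - r <= k / 2]. *)
pose e := k / (4 * pi).
have e0 : 0 < e by rewrite divr_gt0// mulr_gt0.
have pe : 2 * pi * e = k / 2.
  by rewrite /e; move: (pi : R) pp => p p0; field; rewrite gt_eqF.
have e1 : e <= 2^-1.
  by rewrite /e ler_pdivrMr ?mulr_gt0//; lra.
have ln2 : 0 < ln (2 : R) by rewrite ln_gt0//; lra.
suff : e * ln 2 <= itg 0 1 (logp_prod bb 1) by apply: lt_le_trans; rewrite mulr_gt0.
have pc := @itg_logp_prod_lim R bb.
have k2 : 0 < k / 2 by rewrite divr_gt0.
have [N _ HN] := (cvgr0Pnorm_le _).1 (@cvg_harmonic R) (k / 2) k2.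
apply: (cvgr_to_ge pc); exists N => // n /HN /= rn.
have r01 := @radius01 R n; have /andP[r0 r1] := r01.
have cl := logk_cont r01.
have E := @itg_norm_logk R 1 (radius n) bb b ltr01 r01.
rewrite mulr1 in E.
pose g x := `|\sum_(z <- bb) logk (radius n) (x / 1 - (z - b))|.
have cg : continuous g by rewrite /g; cont.
suff : 2 * e * ln 2 <= itg (- (1 / 2)) (1 / 2) g by rewrite E; lra.
rewrite (@itg_chasles _ _ (- e))//; [|lra|lra].
rewrite (@itg_chasles _ (- e) e)//; [|lra|lra].
have h1 : 0 <= itg (- (1 / 2)) (- e) g by apply: itg_ge0 => x _; exact: normr_ge0.
have h2 : 0 <= itg e (1 / 2) g by apply: itg_ge0 => x _; exact: normr_ge0.
suff : 2 * e * ln 2 <= itg (- e) e g by lra.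
have -> : 2 * e * ln 2 = itg (- e) e (fun=> ln 2 : R).
  by rewrite itg_cst; [ring|lra].
apply: le_itg => // [|x /andP[x1 x2]]; first exact: contcst.
have ln4 : ln (4 : R) = ln 2 + ln 2.
  by rewrite -lnM ?posrE//; congr ln; ring.
have lk (z : R) : logk (radius n) z <= ln 2.
  have d0 := den_gt0 (2 * pi * z) r01.
  have : ln (1 - 2 * radius n * cos (2 * pi * z) + radius n ^+ 2) <= ln 4.
    rewrite ler_ln ?posrE//.
    by have := cos_geN1 (2 * pi * z); move: (cos _) => u; nra.
  by rewrite /logk ln4; lra.
have l0 : logk (radius n) (x / 1 - (b - b)) <= - (ln 2 *+ (size bs).+1).
  rewrite subrr subr0 divr1.
  have d0 := den_gt0 (2 * pi * x) r01.
  have lnk : ln k = - (ln 2 *+ (size bs).+1 * 2).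
    by rewrite /k lnV ?posrE ?exprn_gt0// lnXn// ln4 mulr_natr -mulr2n mulrnAC.
  suff : ln (1 - 2 * radius n * cos (2 * pi * x) + radius n ^+ 2) <= ln k.
    by rewrite /logk lnk; lra.
  rewrite ler_ln ?posrE//.
  pose v := 2 * pi * x.
  have cv : 1 - cos v <= v ^+ 2.
    have [v0|v0] := leP 0 v; first exact: cos_ge.
    by rewrite -cosN -sqrrN; apply: cos_ge; rewrite oppr_ge0 ltW.
  have v1 : - (k / 2) <= v <= k / 2.
    have xe : `|x| <= e by rewrite ler_norml x1.
    rewrite -ler_norml /v normrM gtr0_norm ?mulr_gt0// -pe.
    by rewrite ler_wpM2l// ltW// mulr_gt0.
  rewrite -/v; have rn' : 1 - radius n <= k / 2.
    by rewrite /radius opprB addrC subrK; move: rn; rewrite ger0_norm// invr_ge0.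
  have v2 : v ^+ 2 <= k / 16 by move: v1 => /andP[v1 v2]; nra.
  have rr : (1 - radius n) ^+ 2 <= k / 16 by nra.
  by move: (radius n) (cos v) cv r0 r1 rr => r c cv r0 r1 rr; nra.
rewrite /g -normrN (le_trans _ (ler_norm _))// big_cons opprD.
have l1 : \sum_(z <- bs) logk (radius n) (x / 1 - (z - b)) <= ln 2 *+ size bs.
  rewrite -[leRHS]iter_addr_0 -count_predT -big_const_seq.
  by apply: ler_sum => z _; exact: lk.
by move: l0; rewrite mulrS; lra.
Qed.

(** The right-hand side [N / l + K l] is smallest at [l = sqrt (N / K)], with
value [2 sqrt (N K)]; if this is not an admissible [l], then [N <= K] and
[D <= N] suffices. *)
Lemma sqr_le_of_tradeoff (N K D : R) : 0 < N -> 0 < K -> 0 <= D -> D <= N ->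
  (forall l, 1 < l -> D <= N / l + K * l) -> D ^+ 2 <= 4 * (N * K).
Proof.
move=> N0 K0 D0 DN H; pose l := Num.sqrt (N / K).
have lE : l ^+ 2 = N / K by rewrite sqr_sqrtr// divr_ge0// ltW.
have l0 : 0 < l by rewrite sqrtr_gt0 divr_gt0.
have NE : N = K * l ^+ 2 by rewrite lE mulrC divfK// gt_eqF.
have [l1|l1] := ltP 1 l.
  have := H l l1; rewrite NE.
  have -> : K * l ^+ 2 / l = K * l by field; rewrite gt_eqF.
  move=> h; have -> : 4 * (K * l ^+ 2 * K) = (K * l + K * l) ^+ 2 by ring.
  by rewrite lerXn2r ?nnegrE// (le_trans D0).
have NK : N <= K by rewrite NE ler_piMr ?(ltW K0)// expr_le1// ltW.
have : D ^+ 2 <= N ^+ 2 by rewrite lerXn2r ?nnegrE// ltW.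
by move=> h; nra.
Qed.

End Assembly.

Theorem theorem2 (R : realType) (N : nat) (P : {poly R[i]})
    (N_gt0 : (0 < N)%N) (P_monic : P \is monic) (P_deg : size P = N.+1)
    (P0_neq0 : P.[0] != 0) :
  (discrepancy P <=
   (4 / Num.sqrt pi)%:E * sqrte (@constC R) * sqrte (N%:R%:E * height P))%E.
Proof.
pose bs := [seq angle z | z <- roots P].
have sb : size bs = N by rewrite size_map size_roots// P_deg.
have pp := @pi_gt0 R.
set h := itg 0 1 (log_height P).
have hQ : itg 0 1 (logp_prod bs 1) <= h by exact: itg_logp_prod_le.
have h0 : 0 < h by apply: lt_le_trans hQ; apply: itg_logp_prod_gt0; rewrite sb.
have NR : 0 < N%:R :> R by rewrite ltr0n.
have C0 : (0 <= @constC R)%E.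
  apply: le_ereal_inf_tmp => q [F [FA Fn0 ->]].
  rewrite mule_ge0//; first by rewrite le_max Lnorm_ge0.
  have m0 := itg_classA_gt0 FA Fn0.
  by rewrite Lnorm1_F// inver gt_eqF// lee_fin invr_ge0 ltW.
rewrite (heightE P_monic) -/h -EFinM.
apply: ge_ereal_sup => _ [b [c [x [y [/andP[xy yx1] ->]]]]].
set J := [set` _]; rewrite count_anglesE// P_deg /= -/bs.
set D := `| _ |.
have DN : D <= N%:R.
  have c1 : (count (hits J) bs)%:R <= N%:R :> R by rewrite ler_nat -sb count_size.
  have c0 : 0 <= (count (hits J) bs)%:R :> R by [].
  have y0 : 0 <= (y - x) * N%:R by rewrite mulr_ge0// subr_ge0.
  have y1 : (y - x) * N%:R <= N%:R by rewrite ler_piMl//; lra.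
  by rewrite /D ler_norml; apply/andP; split; lra.
have D0 : 0 <= D by exact: normr_ge0.
have cntU th : hits J th -> exists n : int, x <= th + n%:~R <= y.
  move=> /asboolP[t Jt /cis_inj[n tn]]; exists n; rewrite -tn.
  move: Jt; rewrite /J /= in_itv/=.
  by case: (b); case: (c) => /andP[t1 t2]; apply/andP; split => //; exact: ltW.
have cntL th (n : int) : x < th + n%:~R < y -> hits J th.
  move=> /andP[t1 t2]; apply/asboolP; exists (th + n%:~R); last exact: cis_addz.
  rewrite /J /= in_itv/=.
  by case: (b); case: (c); apply/andP; split => //; exact: ltW.
case CE : (@constC R) C0 => [C| |] C0 //; last first.
  (* An infinite infimum makes the right-hand side infinite since [0 < h]. *)
  rewrite [sqrte +oo]/= gt0_muley ?lte_fin ?divr_gt0 ?sqrtr_gt0//.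
  by rewrite gt0_mulye ?leey//= lte_fin sqrtr_gt0 mulr_gt0.
rewrite lee_fin in C0.
have key q : C < q -> D ^+ 2 <= 4 * (N%:R * (4 * q / pi * h)).
  move=> Cq; have q0 : 0 < q by apply: le_lt_trans Cq.
  have : (@constC R < q%:E)%E by rewrite CE lte_fin.
  move=> /ereal_inf_lt[_ [F [FA Fn0 ->]]] qm.
  have [Fe Fc F0 _ _] := FA; have Fs := classA_supp FA; have Fi := cosT_int FA.
  have m0 := itg_classA_gt0 FA Fn0.
  move: qm; rewrite Lnorm1_F//; set m := itg _ _ F in m0 * => qm.
  have : (maxe (Lnorm (@lebesgue_measure R) +oo (fun x => (normc (hilbert_line F x))%:E))
      (Lnorm mu_circle +oo (fun x => (normc (hilbert_circle (periodization F) x))%:E))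
      <= (q * m)%:E)%E.
    by move: qm; rewrite inver gt_eqF// lte_pdivrMr// -EFinM => /ltW.
  rewrite ge_max => /andP[/(hilbert_bounds FA) H /H [hL hC]].
  apply: sqr_le_of_tradeoff => //; first by rewrite !mulr_gt0 ?invr_gt0.
  move=> l l1.
  have := count_bound xy yx1 cntU cntL Fc Fe F0 Fs Fi hL hC bs l1 m0.
  rewrite sb -/D => Hc; apply: le_trans Hc _; rewrite lerD2l.
  have -> : 4 * (q * m) * l / (pi * m) = 4 * q / pi * l.
    by move: (pi : R) pp => p p0; field; rewrite !gt_eqF.
  rewrite -[leRHS]mulrA [h * l]mulrC mulrA ler_pM2l//.
  by rewrite !mulr_gt0 ?invr_gt0//; lra.
have D2 : D ^+ 2 <= 4 * (N%:R * (4 * C / pi * h)).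
  pose a := 4 * (N%:R * (4 / pi * h)).
  have a0 : 0 < a by rewrite !mulr_gt0 ?invr_gt0.
  apply/ler_addgt0Pr => eps eps0.
  have := key (C + eps / a) ltac:(by rewrite ltrDl divr_gt0).
  have -> : 4 * (N%:R * (4 * (C + eps / a) / pi * h)) = 4 * (N%:R * (4 * C / pi * h)) +
      4 * (N%:R * (4 / pi * h)) * (eps / a) by ring.
  by rewrite -/a [a * _]mulrC divfK// gt_eqF.
rewrite /= -!EFinM lee_fin -ler_sqr ?nnegrE//.
apply: le_trans D2 _; rewrite !exprMn exprVn !sqr_sqrtr ?mulr_ge0 ?(ltW h0) ?(ltW pp)//.
by move: (pi : R) pp => p p0; rewrite le_eqVlt; apply/orP; left; apply/eqP; field; rewrite gt_eqF.
Qed.
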